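(* Let $D$ be a GMPD domain with $|\operatorname{Max}(D)|<\infty$, and let $n_1,n_2,n_3,n_4$ be the non-negative integers such that $|\{M\in \operatorname{Max}(D) \mid D_M \text{ is } \mathcal{K}_i\}|=n_i$ for $1\leq i\leq 4$, where $\mathcal{K}_1$ = two-generated PVD but not DVR, and $\mathcal{K}_j$ = valuation domain with value group $G_j$ for $j=2,3,4$, with $G_2=\mathbb{R}$, $G_3=\mathbb{Z}\times\mathbb{Z}$ and $G_4=\mathbb{Z}$. Then: (a) $|\mathcal{O}_{ql}(D)|=2(n_{1}+n_{3})+(n_{2}+n_{4})+1$; (b) $D$ is Noetherian if and only if $|\mathcal{O}_{ql}(D)|=2n_{1}+n_{4}+1$; (c) $D$ is Prüfer if and only if $|\mathcal{O}_{ql}(D)|=2n_{3}+(n_{2}+n_{4})+1$; (d) $D$ is Dedekind if and only if $|\mathcal{O}_{ql}(D)|=n_{4}+1$.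
   Context: All rings are commutative unitary integral domains. A pseudo-valuation domain (PVD) is a domain $D$ with quotient field $K$ in which every prime ideal $P$ is strongly prime, i.e. whenever $xy\in P$ with $x,y\in K$, then $x\in P$ or $y\in P$. A domain is two-generated if each of its ideals can be generated by two elements. A DVR is a valuation domain with value group $\mathbb{Z}$. Value groups are considered up to isomorphism of ordered groups, and $\mathbb{Z}\times\mathbb{Z}$ carries the lexicographic order. A ring is quasi-local if it has exactly one maximal ideal (no Noetherian assumption). For an integral domain $D$ with quotient field $K$, an overring of $D$ is a subring of $K$ containing $D$; $\mathcal{O}_{ql}(D)$ is the set of those overrings of $D$ which are quasi-local. $\operatorname{Max}(D)$ is the set of maximal ideals of $D$, and $D_M$ is the localization of $D$ at $M$. $D$ is h-local if each nonzero ideal of $D$ is contained in only finitely many maximal ideals and each nonzero prime ideal is contained in a unique maximal ideal. An MNI ideal of $D$ is an ideal of $D$ which is maximal (under inclusion) among the non-invertible ideals of $D$ (the zero ideal counts as non-invertible). $D$ is an MPD domain if it has a unique MNI ideal $Q$ and every nonzero non-invertible ideal of $D$ can be written as $JQ$ for some invertible ideal $J$ of $D$. $D$ is a GMPD domain (globalized multiplicatively pinched-Dedekind domain) if $D$ is h-local and the localization $D_M$ is an MPD domain for every maximal ideal $M$ of $D$.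
   Formalization: The formal theorem additionally assumes that D is not a field: with the definitions taken literally a field is a GMPD domain with n1 = 1 and n2 = n3 = n4 = 0 but only one quasi-local overring, so (a) and (b) fail for fields. *)

(* Defs.v *)
From mathcomp Require Import all_boot all_order all_algebra.
From mathcomp Require Import boolp classical_sets cardinality reals.
Set Implicit Arguments.
Unset Strict Implicit.
Unset Printing Implicit Defensive.
Import Order.TTheory GRing.Theory Num.Theory.
Local Open Scope classical_set_scope.
Local Open Scope card_scope.
Local Open Scope ring_scope.

(* An integral domain A with quotient field K is represented by its image in
   K, as a subset of K; its localizations and overrings are then subsets of K
   as well, and have the same quotient field. *)

Section Domains.
Variable K : fieldType.
Implicit Types A B I J M P Q X : set K.

Definition is_subring A : Prop := subring_closed (mem A).

Definition is_domain_of A : Prop :=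
  is_subring A /\
  forall x, exists a b, [/\ A a, A b, b != 0 & x = a / b].

Definition is_field A : Prop := forall x, A x -> x != 0 -> A x^-1.

Definition is_submodule A M : Prop :=
  [/\ M 0, (forall x y, M x -> M y -> M (x + y))
    & (forall a x, A a -> M x -> M (a * x))].

Definition span A X : set K := smallest (is_submodule A) X.

Definition is_ideal A I : Prop := is_submodule A I /\ I `<=` A.

Definition is_fractional_ideal A J : Prop :=
  is_submodule A J /\
  exists d, [/\ A d, d != 0 & forall x, J x -> A (d * x)].

Definition ideal_mul A I J : set K :=
  span A [set z | exists x y, [/\ I x, J y & z = x * y]].

Definition is_prime_ideal A P : Prop :=
  [/\ is_ideal A P, P <> A
    & forall x y, A x -> A y -> P (x * y) -> P x \/ P y].

Definition is_maximal_ideal A M : Prop :=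
  [/\ is_ideal A M, M <> A
    & forall I, is_ideal A I -> M `<=` I -> I = M \/ I = A].

Definition Max A : set (set K) := [set M | is_maximal_ideal A M].

Definition localization A P : set K :=
  [set x | exists a s, [/\ A a, A s, ~ P s & x = a / s]].

Definition quasi_local A : Prop := exists M, Max A = [set M].

Definition is_overring A B : Prop := is_subring B /\ A `<=` B.

Definition O_ql A : set (set K) := [set B | is_overring A B /\ quasi_local B].

Definition is_invertible A I : Prop :=
  exists J, is_fractional_ideal A J /\ ideal_mul A I J = A.

Definition is_MNI A Q : Prop :=
  [/\ is_ideal A Q, ~ is_invertible A Q
    & forall I, is_ideal A I -> ~ is_invertible A I -> Q `<=` I -> I = Q].

Definition is_MPD A : Prop :=
  exists Q, [set Q' | is_MNI A Q'] = [set Q] /\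
    forall I, is_ideal A I -> I <> [set 0] -> ~ is_invertible A I ->
      exists J, [/\ is_ideal A J, is_invertible A J & I = ideal_mul A J Q].

Definition is_h_local A : Prop :=
  (forall I, is_ideal A I -> I <> [set 0] ->
     finite_set [set M | Max A M /\ I `<=` M]) /\
  (forall P, is_prime_ideal A P -> P <> [set 0] ->
     exists! M, Max A M /\ P `<=` M).

Definition is_GMPD A : Prop :=
  is_h_local A /\ forall M, Max A M -> is_MPD (localization A M).

Definition is_PVD A : Prop :=
  forall P, is_prime_ideal A P -> forall x y, P (x * y) -> P x \/ P y.

Definition two_generated A : Prop :=
  forall I, is_ideal A I -> exists a b, I = span A [set a; b].

Definition is_valuation_domain A : Prop :=
  forall x, x != 0 -> A x \/ A x^-1.

(* The value group of a valuation domain A is K^* / A^*, ordered by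
   x A^* <= y A^* iff y / x is in A.  An isomorphism of it onto (G, le) is
   given by a map v, relevant on K^* only; that v factors through an injection
   on K^* / A^* follows from the last condition as le is antisymmetric. *)
Definition has_value_group A (G : zmodType) (le : rel G) : Prop :=
  exists v : K -> G,
    [/\ (forall x y, x != 0 -> y != 0 -> v (x * y) = v x + v y),
        (forall g, exists2 x, x != 0 & v x = g)
      & (forall x y, x != 0 -> y != 0 -> le (v x) (v y) <-> A (y / x))].

Definition is_valuation_domain_with_group A (G : zmodType) (le : rel G) : Prop :=
  is_valuation_domain A /\ has_value_group A le.

Definition le_int : rel int := fun x y => x <= y.

Definition le_lexi_int : rel (int * int) :=
  fun x y => ((x : int *l int) <= (y : int *l int))%O.

Definition le_real (R : realType) : rel R := fun x y => x <= y.

Definition is_DVR A : Prop := is_valuation_domain_with_group A le_int.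

Definition in_K1 A : Prop := [/\ two_generated A, is_PVD A & ~ is_DVR A].

Definition in_K2 (R : realType) A : Prop :=
  is_valuation_domain_with_group A (@le_real R).

Definition in_K3 A : Prop := is_valuation_domain_with_group A le_lexi_int.

Definition in_K4 A : Prop := is_valuation_domain_with_group A le_int.

Definition finitely_generated A I : Prop :=
  exists2 X : set K, finite_set X & I = span A X.

Definition is_Noetherian A : Prop :=
  forall I, is_ideal A I -> finitely_generated A I.

Definition is_Prufer A : Prop :=
  forall I, is_ideal A I -> I <> [set 0] -> finitely_generated A I ->
    is_invertible A I.

Definition is_Dedekind A : Prop :=
  forall I, is_ideal A I -> I <> [set 0] -> is_invertible A I.

End Domains.

(* Main.v *)
From mathcomp Require Import all_boot all_order all_algebra.
From mathcomp Require Import boolp classical_sets cardinality reals.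
From mathcomp Require Import finmap ring lra zify.
Require Import Defs.
Set Implicit Arguments.
Unset Strict Implicit.
Unset Printing Implicit Defensive.
Import Order.TTheory GRing.Theory Num.Theory.
Local Open Scope classical_set_scope.
Local Open Scope card_scope.
Local Open Scope ring_scope.

(** Let [D] be a GMPD domain with finitely many maximal ideals, and not a
    field. A quasi-local overring [B <> K] of [D] has its maximal ideal lying
    over a nonzero prime of [D], and by h-locality this prime lies in exactly
    one maximal ideal [M]; equivalently [B] contains [D_M] for exactly one [M]
    ([quasi_local_overring_max]). So the quasi-local overrings of [D] are [K]
    and, for each [M] separately, those of [D_M] other than [K]. It remains to
    find the overrings of a local MPD domain [A] with maximal ideal [M <> 0].

    In a local domain invertible means principal and nonzero, so with [Q] the
    unique MNI ideal every nonzero ideal of [A] is [x A] or [x Q] with [x] in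
    [A]; this is what [pinched] records. The main tool is that a nonzero ideal
    stable under division by a nonunit [m] cannot be principal, hence is [x Q],
    and [Q] is stable as well ([pin_div_closed]). In particular the powers of
    an element of [Q] have no nonzero common multiple ([pin_separated]).
    There are four cases.

    - [A] is not a valuation domain. Two elements neither of which divides the
      other generate a multiple of [Q], so [Q] has two generators, and
      Nakayama's lemma gives [Q = M]. The same dichotomy applied to the square
      of [M] yields [M M = x M], so [B = (M : M)] satisfies [M = x B]; it
      turns out to be a discrete valuation domain with maximal ideal [M]. Hence
      [A] is a two-generated PVD, and its overrings are [A], [B] and [K].
    - [A] is a valuation domain and [M] is not principal. Then [Q = M] and [A]
      has rank one, so its value group embeds in the reals by Hoelder's
      construction ([real_value]); the embedding is onto because the ideal of elements of
      value above [r] is [z A] or [z M], which forces [z] to have value [r].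
      The overrings are [A] and [K].
    - [A] is a valuation domain, [M = p A] and the intersection of the
      [p ^ n A] is nonzero. This intersection is [Q], and the ring [W] obtained
      by inverting [p] is a discrete valuation domain with maximal ideal
      [Q = t W]. Each nonzero element is a unit times [t ^ n * p ^ m], so the
      value group is [Z * Z] ordered lexicographically, and the overrings are
      [A], [W] and [K].
    - [A] is a valuation domain, [M = p A] and that intersection is zero. Then
      [A] is a discrete valuation domain, with overrings [A] and [K].

    The cases exclude one another, and each is read off from the corresponding
    class of the statement ([K1P], [K2P], [K3P], [K4P]), so counting one or two
    overrings for each [M] and adding [K] gives the cardinality. The
    ideals of the first and the last case have two generators, while a
    Noetherian valuation domain is discrete; as there are finitely many
    maximal ideals, [D] is Noetherian exactly when the second and the third
    case do not occur. It is Pruefer exactly when the first does not occur,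
    and Dedekind when it is both Noetherian and Pruefer. The remaining claims
    are arithmetic of the counts. *)

(** * Subrings, submodules and ideals inside a field *)

Section Subrings.
Variable K : fieldType.
Implicit Types (A I M N X : set K) (x y z a b : K).

Lemma subring1 A : is_subring A -> A 1.
Proof. by case=> h _ _; apply/set_mem. Qed.

Lemma subringB A x y : is_subring A -> A x -> A y -> A (x - y).
Proof. by case=> _ h _ Ax Ay; apply/set_mem/h; exact/mem_set. Qed.

Lemma subringM A x y : is_subring A -> A x -> A y -> A (x * y).
Proof. by case=> _ _ h Ax Ay; apply/set_mem/h; exact/mem_set. Qed.

Lemma subring0 A : is_subring A -> A 0.
Proof. by move=> rA; rewrite -(subrr 1); apply: subringB => //; apply: subring1. Qed.

Lemma subringN A x : is_subring A -> A x -> A (- x).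
Proof. by move=> rA Ax; rewrite -sub0r; apply: subringB => //; apply: subring0. Qed.

Lemma subringD A x y : is_subring A -> A x -> A y -> A (x + y).
Proof.
by move=> rA Ax Ay; rewrite -[y]opprK; apply: subringB => //; apply: subringN.
Qed.

Lemma subringX A x n : is_subring A -> A x -> A (x ^+ n).
Proof.
move=> rA Ax; elim: n => [|n IHn]; first exact: subring1.
by rewrite exprS; apply: subringM.
Qed.

Lemma is_subringP A : A 1 -> (forall x y, A x -> A y -> A (x - y)) ->
  (forall x y, A x -> A y -> A (x * y)) -> is_subring A.
Proof.
move=> A1 AB AM; split; first exact/mem_set.
- by move=> x y /set_mem Ax /set_mem Ay; apply/mem_set/AB.
- by move=> x y /set_mem Ax /set_mem Ay; apply/mem_set/AM.
Qed.

Lemma submodule0 A I : is_submodule A I -> I 0. Proof. by case. Qed.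

Lemma submoduleD A I x y : is_submodule A I -> I x -> I y -> I (x + y).
Proof. by case=> _ h _; apply: h. Qed.

Lemma submoduleZ A I a x : is_submodule A I -> A a -> I x -> I (a * x).
Proof. by case=> _ _ h; apply: h. Qed.

Lemma is_submodule_self A : is_subring A -> is_submodule A A.
Proof.
move=> rA; split=> [|x y|a x]; first exact: subring0.
- exact: subringD.
- exact: subringM.
Qed.

Lemma span_min A X N : is_submodule A N -> X `<=` N -> span A X `<=` N.
Proof. by move=> sN XN; apply: smallest_sub. Qed.

Lemma sub_span A X : X `<=` span A X.
Proof. exact: sub_smallest. Qed.

Lemma span_submodule A X : is_submodule A (span A X).
Proof.
split=> [N [sN _]|x y hx hy N [sN XN]|a x Aa hx N [sN XN]].
- exact: submodule0 sN.
- by apply: (submoduleD sN); [apply: hx|apply: hy].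
- by apply: (submoduleZ sN) => //; apply: hx.
Qed.

(** The multiple [x I] for [x <> 0]. As a preimage it makes membership in
    [x A] the divisibility condition [A (z / x)]. *)
Definition scale x I : set K := [set z | I (z / x)].

Lemma scale_mem x I y : x != 0 -> I y -> scale x I (x * y).
Proof. by move=> x0 Iy; rewrite /scale /= mulrAC divff // mul1r. Qed.

Lemma scale_id x A : is_subring A -> x != 0 -> scale x A x.
Proof. by move=> rA x0; rewrite /scale /= divff //; apply: subring1. Qed.

Lemma scale1 I : scale 1 I = I.
Proof. by apply/seteqP; split=> z; rewrite /scale /= divr1. Qed.

Lemma scale_submodule A I x : is_submodule A I -> is_submodule A (scale x I).
Proof.
move=> sI; split=> [|y z|a y]; rewrite /scale /=.
- by rewrite mul0r; apply: submodule0 sI.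
- by rewrite mulrDl; apply: submoduleD sI.
- by rewrite -mulrA; apply: submoduleZ sI.
Qed.

Definition principal A I := exists2 x, x != 0 & I = scale x A.

Lemma scale_associate A x y : is_subring A -> x != 0 -> y != 0 ->
  A (x / y) -> A (y / x) -> scale x A = scale y A.
Proof.
move=> rA x0 y0 xy yx; apply/seteqP; split=> z; rewrite /scale /= => h.
- by rewrite (_ : z / y = z / x * (x / y)) ?[RHS]mulrA ?divfK //; exact: subringM.
- by rewrite (_ : z / x = z / y * (y / x)) ?[RHS]mulrA ?divfK //; exact: subringM.
Qed.

Lemma nonzero_elt A I : is_submodule A I -> I <> [set 0] ->
  exists2 x, x != 0 & I x.
Proof.
move=> sI; apply: contra_notP => h; apply/seteqP; split=> x.
- by move=> Ix; apply/eqP/negPn/negP => x0; apply: h; exists x.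
- by move=> ->; apply: submodule0 sI.
Qed.

Lemma nonzero_set I x : x != 0 -> I x -> I <> [set 0].
Proof. by move=> x0 Ix eI; move: Ix x0; rewrite eI => /= ->; rewrite eqxx. Qed.

Lemma is_ideal_self A : is_subring A -> is_ideal A A.
Proof. by move=> rA; split=> //; apply: is_submodule_self. Qed.

Lemma ideal_scale A I x : is_subring A -> is_ideal A I -> A x -> x != 0 ->
  is_ideal A (scale x I).
Proof.
move=> rA [sI IA] Ax x0; split; first exact: scale_submodule.
by move=> z /IA h; rewrite -(divfK x0 z); apply: subringM.
Qed.

Lemma ideal_unit A I : is_ideal A I -> I 1 -> I = A.
Proof.
move=> [sI IA] I1; apply/seteqP; split=> // x Ax.
by rewrite -(mulr1 x); apply: (submoduleZ sI).
Qed.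

Definition gen2 A a b : set K :=
  [set z | exists c d, [/\ A c, A d & z = c * a + d * b]].

Lemma gen2_submodule A a b : is_subring A -> is_submodule A (gen2 A a b).
Proof.
move=> rA; split=> [|_ _ [c [d [Ac Ad ->]]] [c' [d' [Ac' Ad' ->]]]|].
- by exists 0, 0; rewrite !mul0r addr0; split=> //; apply: subring0.
- by exists (c + c'), (d + d'); split; [apply: subringD..|ring].
- move=> e _ Ae [c [d [Ac Ad ->]]].
  by exists (e * c), (e * d); split; [apply: subringM..|ring].
Qed.

Lemma gen2_l A a b : is_subring A -> gen2 A a b a.
Proof.
by move=> rA; exists 1, 0; split; [apply: subring1|apply: subring0|ring].
Qed.

Lemma gen2_r A a b : is_subring A -> gen2 A a b b.
Proof.
by move=> rA; exists 0, 1; split; [apply: subring0|apply: subring1|ring].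
Qed.

Lemma gen2_min A N a b : is_submodule A N -> N a -> N b -> gen2 A a b `<=` N.
Proof.
move=> sN Na Nb _ [c [d [Ac Ad ->]]].
by apply: (submoduleD sN); apply: (submoduleZ sN).
Qed.

Lemma span2 A a b : is_subring A -> span A [set a; b] = gen2 A a b.
Proof.
move=> rA; apply/seteqP; split.
- apply: span_min; first exact: gen2_submodule.
  by move=> _ [] ->; [apply: gen2_l|apply: gen2_r].
- apply: gen2_min; first exact: span_submodule.
  + by apply: sub_span; left.
  + by apply: sub_span; right.
Qed.

Lemma gen2_ideal A a b : is_subring A -> A a -> A b -> is_ideal A (gen2 A a b).
Proof.
move=> rA Aa Ab; split; first exact: gen2_submodule.
by apply: gen2_min => //; apply: is_submodule_self.
Qed.

Lemma gen2_scale A x : is_subring A -> x != 0 ->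
  gen2 A x x = scale x A.
Proof.
move=> rA x0; apply/seteqP; split=> [|z].
  by apply: gen2_min; [apply/scale_submodule/is_submodule_self|exact: scale_id..].
rewrite /scale /= => h; exists (z / x), 0; split=> //; first exact: subring0.
by rewrite divfK // mul0r addr0.
Qed.

Lemma gen2_zero A : is_subring A -> gen2 A 0 0 = [set 0].
Proof.
move=> rA; apply/seteqP; split=> z.
- by move=> [c [d [_ _ ->]]]; rewrite !mulr0 addr0.
- by move=> ->; apply: gen2_l.
Qed.

(** * Local domains *)

(** The pair of a local domain and its maximal ideal. The condition on units
    is what every argument uses, so it replaces uniqueness of the maximal
    ideal, from which it follows only by Zorn's lemma. *)
Record local_domain A M : Prop := LocalDomain {
  local_domP : is_domain_of A;
  local_idealP : is_ideal A M;
  local_proper : ~ M 1;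
  local_unit : forall x, A x -> ~ M x -> A x^-1 }.

Lemma local_subring A M : local_domain A M -> is_subring A.
Proof. by case=> -[]. Qed.

Lemma local_frac A M x : local_domain A M ->
  exists a b, [/\ A a, A b, b != 0 & x = a / b].
Proof. by case=> -[_ h] _ _ _; apply: h. Qed.

Lemma local_sub A M : local_domain A M -> M `<=` A.
Proof. by case=> _ []. Qed.

Lemma local_submod A M : local_domain A M -> is_submodule A M.
Proof. by case=> _ []. Qed.

Lemma local_nonunit A M x : local_domain A M -> M x -> x != 0 -> ~ A x^-1.
Proof.
move=> lA Mx x0 Ax; apply: (local_proper lA).
by rewrite -(mulVf x0); apply: (submoduleZ (local_submod lA)).
Qed.

Lemma local_nonunitP A M x : local_domain A M -> A x -> ~ A x^-1 -> M x.
Proof. by move=> lA Ax; apply: contra_notP; exact: (local_unit lA). Qed.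

Lemma local_mul_unit A M x y : local_domain A M -> A x -> A y ->
  ~ M (x * y) -> ~ M x.
Proof.
move=> lA Ax Ay; apply: contra_not => Mx; rewrite mulrC.
exact: (submoduleZ (local_submod lA)).
Qed.

Lemma local_unit_sum A M x y : local_domain A M -> ~ M (x + y) ->
  ~ M x \/ ~ M y.
Proof.
move=> lA h; have [Mx|] := pselect (M x); last by left.
by right=> My; apply: h; apply: (submoduleD (local_submod lA)).
Qed.

Lemma local_valuation_max A M x : local_domain A M -> is_valuation_domain A ->
  ~ A x -> M x^-1.
Proof.
move=> lA vA nAx; have x0 : x != 0.
  by apply: contra_notN nAx => /eqP ->; exact: subring0 (local_subring lA).
have [//|Ax'] := vA _ x0.
by apply: (local_nonunitP lA) => //; rewrite invrK.
Qed.

(** In [z = c a + d b] one of [c (a / z)] and [d (b / z)] is a unit, since they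
    add up to [1]; the corresponding generator is an associate of [z]. *)
Lemma gen2_principal A M a b z : local_domain A M -> z != 0 ->
  gen2 A a b = scale z A ->
  (a != 0 /\ gen2 A a b = scale a A) \/ (b != 0 /\ gen2 A a b = scale b A).
Proof.
move=> lA z0 eI; have rA := local_subring lA.
have : scale z A a by rewrite -eI; apply: gen2_l.
rewrite /scale /= => Aaz.
have : scale z A b by rewrite -eI; apply: gen2_r.
rewrite /scale /= => Abz.
have [c [d [Ac Ad e]]] : gen2 A a b z by rewrite eI; apply: scale_id.
have e1 : a / z * c + b / z * d = 1.
  by rewrite -(divff z0) {3}e; ring.
have : ~ M (a / z * c + b / z * d) by rewrite e1; apply: local_proper lA.
have key w : A w -> ~ M w -> A (w^-1) /\ w != 0.
  move=> Aw nMw; split; first exact: (local_unit lA).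
  by apply: contra_notN nMw => /eqP ->; exact: submodule0 (local_submod lA).
move=> /(local_unit_sum lA)[] /(local_mul_unit lA) => [/(_ Aaz Ac)|/(_ Abz Ad)].
- move=> /(key _ Aaz) []; rewrite invf_div => h.
  rewrite mulf_eq0 negb_or => /andP[a0 _]; left; split=> //.
  by rewrite eI; apply: scale_associate.
- move=> /(key _ Abz) []; rewrite invf_div => h.
  rewrite mulf_eq0 negb_or => /andP[b0 _]; right; split=> //.
  by rewrite eI; apply: scale_associate.
Qed.

(** Nakayama's argument with two generators: in [a = c a + d b] the coefficient
    [1 - c] is a unit, so [b] alone generates. *)
Lemma nakayama2 A M a b : local_domain A M -> gen2 A a b <> [set 0] ->
  (forall z, gen2 A a b z -> exists c d, [/\ M c, M d & z = c * a + d * b]) ->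
  principal A (gen2 A a b).
Proof.
move=> lA nz h; have rA := local_subring lA.
have [c [d [Mc Md e]]] := h _ (gen2_l a b rA).
have nM : ~ M (1 - c).
  move=> Mc1; apply: (local_proper lA); rewrite -(subrK c 1).
  exact: (submoduleD (local_submod lA)).
have A1c : A (1 - c).
  by apply: subringB => //; [apply: subring1|apply: local_sub lA _ _].
have c1 : 1 - c != 0.
  by apply: contra_notN nM => /eqP ->; exact: submodule0 (local_submod lA).
have Ai := local_unit lA A1c nM.
have e' : a = (1 - c)^-1 * d * b.
  rewrite -mulrA; apply: (mulfI c1); rewrite mulVKf // mulrBl mul1r.
  by rewrite {1}e addrC addKr.
have Aab : A ((1 - c)^-1 * d) by apply: subringM => //; apply: local_sub lA _ _.
have [b0|b0] := eqVneq b 0.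
  by case: nz; rewrite e' b0 mulr0 gen2_zero.
exists b => //; apply/seteqP; split.
- apply: gen2_min; first exact/scale_submodule/is_submodule_self.
  + by rewrite /scale /= e' mulfK.
  + exact: scale_id.
- move=> z hz; rewrite -(divfK b0 z).
  by apply: (submoduleZ (gen2_submodule a b rA) hz); apply: gen2_r.
Qed.

Lemma local_maximal_ideal A M I : local_domain A M -> is_ideal A I -> I <> A ->
  I `<=` M.
Proof.
move=> lA iI nI x Ix; apply: contrapT => nMx; apply: nI.
apply: ideal_unit => //; have x0 : x != 0.
  by apply: contra_notN nMx => /eqP ->; exact: submodule0 (local_submod lA).
rewrite -(mulVf x0); apply: (submoduleZ iI.1) => //.
by apply: (local_unit lA) => //; apply: iI.2.
Qed.

Lemma local_quasi_local A M : local_domain A M -> quasi_local A.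
Proof.
move=> lA; have iM := local_idealP lA.
have MA : M <> A.
  by move=> e; apply: (local_proper lA); rewrite e; apply: subring1 (local_subring lA).
exists M; apply/seteqP; split=> N.
- case=> iN NA mN; have NM := local_maximal_ideal lA iN NA.
  by case: (mN _ iM NM) => // /MA.
- move=> ->; split=> // I iI MI.
  have [->|IA] := pselect (I = A); [by right|left].
  by apply/seteqP; split=> //; apply: local_maximal_ideal lA iI IA.
Qed.

End Subrings.

(** * Uniformizers, overrings and value groups *)

Section Valuations.
Variable K : fieldType.
Implicit Types (A B C I J M N X : set K) (x y z a b p m : K).

(** The last clause is the archimedean property, which a valuation domain with
    principal maximal ideal lacks when its rank exceeds one. *)
Definition uniformizer A M p : Prop :=
  [/\ p != 0, M = scale p A & forall y, (forall n, A (y / p ^+ n)) -> y = 0].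

Lemma order_of_vanishing A M p z : local_domain A M -> p != 0 ->
  M = scale p A -> A z -> (exists n, ~ A (z / p ^+ n)) ->
  exists n : nat, A (z / p ^+ n) /\ A (p ^+ n / z).
Proof.
move=> lA p0 eM Az [n0 hn0]; have ex : exists n, `[< ~ A (z / p ^+ n) >].
  by exists n0; apply/asboolP.
case: (ex_minnP ex) => -[|n] /asboolP hn hmin.
  by case: hn; rewrite expr0 divr1.
have An : A (z / p ^+ n).
  by apply: contrapT => /asboolP /hmin; rewrite ltnn.
exists n; split=> //; rewrite -invf_div.
apply: (local_unit lA An); rewrite eM /scale /= => h; apply: hn.
by rewrite exprSr invfM mulrA.
Qed.

Lemma uniformizer_decomp A M p y : local_domain A M -> uniformizer A M p ->
  y != 0 -> exists k : int, A (y / p ^ k) /\ A (p ^ k / y).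
Proof.
move=> lA [p0 eM sep] y0; have rA := local_subring lA.
have dec z : A z -> z != 0 -> exists n : nat, A (z / p ^+ n) /\ A (p ^+ n / z).
  move=> Az z0; apply: (order_of_vanishing lA) => //.
  apply: contrapT => h; move/eqP: z0; apply; apply: sep => n.
  by apply: contrapT => hn; apply: h; exists n.
have [a [b [Aa Ab b0 e]]] := local_frac y lA.
have a0 : a != 0 by apply: contra_neq y0 => a0; rewrite e a0 mul0r.
have [n [An An']] := dec _ Aa a0; have [m [Bm Bm']] := dec _ Ab b0.
exists (n%:Z - m%:Z); rewrite expfzDr // -invr_expz -!exprnP e.
have pn0 := expf_neq0 n p0; have pm0 := expf_neq0 m p0.
split.
- rewrite [X in A X](_ : _ = (a / p ^+ n) * (p ^+ m / b)); first exact: subringM.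
  by field; rewrite pn0 pm0 b0.
- rewrite [X in A X](_ : _ = (p ^+ n / a) * (b / p ^+ m)); first exact: subringM.
  by field; rewrite pm0 a0 b0.
Qed.

Lemma uniformizer_valuation A M p : local_domain A M -> uniformizer A M p ->
  is_valuation_domain A.
Proof.
move=> lA uA x x0; have rA := local_subring lA.
have [k [h1 h2]] := uniformizer_decomp lA uA x0.
have [p0 eM _] := uA; have Ap : A p.
  by apply: (local_sub lA); rewrite eM; exact: scale_id.
have pk0 : p ^ k != 0 by rewrite expfz_neq0.
case: k h1 h2 pk0 => n h1 h2 pk0.
- by left; rewrite -(divfK pk0 x) -exprnP; apply: subringM => //; exact: subringX.
- right; rewrite (_ : x^-1 = (p ^ Negz n / x) * (p ^ Negz n)^-1).
    by apply: subringM => //; rewrite NegzE -invr_expz invrK -exprnP; exact: subringX.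
  by rewrite mulrAC divff // mul1r.
Qed.

(** If the powers of [m] have no nonzero common multiple, each [y^-1] divides
    some power of [m], so [y] is in [A [m^-1]]. *)
Lemma overring_full A C m : is_subring C -> A `<=` C ->
  is_valuation_domain A -> m != 0 -> C m^-1 ->
  (forall y, (forall n, A (y / m ^+ n)) -> y = 0) -> C = setT.
Proof.
move=> rC AC vA m0 Cm sep; apply/seteqP; split=> // y _.
have [->|y0] := eqVneq y 0; first exact: subring0.
have [n hn] : exists n, ~ A (y^-1 / m ^+ n).
  apply: contrapT => h; have /eqP : y^-1 = 0.
    by apply: sep => n; apply: contrapT => hn; apply: h; exists n.
  by rewrite invr_eq0 (negPf y0).
have mn0 := expf_neq0 n m0.
have nz : y^-1 / m ^+ n != 0 by rewrite mulf_neq0 ?invr_neq0.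
have [/hn //|] := vA _ nz.
rewrite invfM !invrK => h; rewrite -(mulfK mn0 y) -exprVn.
by apply: subringM => //; [exact: AC|exact: subringX].
Qed.

(** To exhibit a value group it is enough to choose multiplicatively one element
    [e g] in each class of associates. *)
Lemma value_group_of_section A (G : zmodType) (le : rel G) (e : G -> K) :
  is_subring A -> antisymmetric le ->
  (forall g, e g != 0) -> (forall g h, e (g + h) = e g * e h) ->
  (forall g h, le g h <-> A (e h / e g)) ->
  (forall y, y != 0 -> exists g, A (y / e g) /\ A (e g / y)) ->
  has_value_group A le.
Proof.
move=> rA asym e0 eD leE cov.
have /choice[v hv] y : exists g, y != 0 -> A (y / e g) /\ A (e g / y).
  have [->|y0] := eqVneq y 0; first by exists 0.
  by have [g hg] := cov _ y0; exists g.
have trA x y z : y != 0 -> A (x / y) -> A (y / z) -> A (x / z).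
  move=> y0 h1 h2; rewrite (_ : x / z = (x / y) * (y / z)).
    exact: subringM.
  by rewrite mulrA divfK.
have uniq x g : x != 0 -> A (x / e g) -> A (e g / x) -> v x = g.
  move=> x0 h1 h2; have [h3 h4] := hv x x0; apply: asym; apply/andP.
  by split; apply/leE; apply: (trA _ x).
exists v; split.
- move=> x y x0 y0; apply: uniq; first by rewrite mulf_neq0.
  + rewrite eD invfM mulrACA.
    by apply: subringM => //; have [] := hv _ x0; have [] := hv _ y0.
  + rewrite eD invfM mulrACA.
    by apply: subringM => //; have [] := hv _ x0; have [] := hv _ y0.
- move=> g; exists (e g) => //; apply: uniq => //.
  + by rewrite divff //; exact: subring1.
  + by rewrite divff //; exact: subring1.
- move=> x y x0 y0; have [x1 x2] := hv _ x0; have [y1 y2] := hv _ y0.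
  rewrite leE; split=> h.
  + by apply: (trA _ (e (v y))) => //; apply: (trA _ (e (v x))).
  + by apply: (trA _ y) => //; apply: (trA _ x).
Qed.

End Valuations.

(** * Invertible ideals of a local domain *)

Section InvertibleIdeals.
Variable K : fieldType.
Implicit Types (A B C I J M N X : set K) (x y z a b p m : K).

Lemma mem_ideal_mul A I J x y : I x -> J y -> ideal_mul A I J (x * y).
Proof. by move=> Ix Jy; apply: sub_span; exists x, y. Qed.

Lemma ideal_mul_sub A I J N : is_submodule A N ->
  (forall x y, I x -> J y -> N (x * y)) -> ideal_mul A I J `<=` N.
Proof.
move=> sN h; apply: span_min => // _ [x [y [Ix Jy ->]]]; exact: h.
Qed.

Lemma ideal_mul_scale A x Q : is_subring A -> x != 0 -> is_submodule A Q ->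
  ideal_mul A (scale x A) Q = scale x Q.
Proof.
move=> rA x0 sQ; apply/seteqP; split.
- apply: ideal_mul_sub; first exact: scale_submodule.
  move=> y z; rewrite /scale /= => hy Qz; rewrite mulrAC.
  exact: (submoduleZ sQ).
- move=> z; rewrite /scale /= => hz; rewrite -(divfK x0 z) mulrC.
  by apply: mem_ideal_mul => //; exact: scale_id.
Qed.

Lemma principal_invertible A I : is_subring A -> is_ideal A I ->
  principal A I -> is_invertible A I.
Proof.
move=> rA [_ IA] [x x0 eI]; exists (scale x^-1 A).
have sA := is_submodule_self rA.
have x'0 : x^-1 != 0 by rewrite invr_neq0.
split; last first.
  rewrite eI ideal_mul_scale //; last exact: scale_submodule.
  apply/seteqP; split=> z; rewrite /scale /=.
  + by rewrite invrK divfK.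
  + by rewrite invrK divfK.
split; first exact: scale_submodule.
exists x; split=> //; first by apply: IA; rewrite eI; apply: scale_id.
by move=> y; rewrite /scale /= invrK mulrC.
Qed.

(** Some product [i * j] in the witness of invertibility is a unit, as all would
    be in [M] otherwise; then [i] generates the ideal. *)
Lemma invertible_principal A M I : local_domain A M -> is_ideal A I ->
  is_invertible A I -> principal A I.
Proof.
move=> lA [sI IA] [J [_ eA]]; have rA := local_subring lA.
have [i [j [Ii Jj nM]]] : exists i j, [/\ I i, J j & ~ M (i * j)].
  apply: contrapT => h; apply: (local_proper lA).
  have : ideal_mul A I J 1 by rewrite eA; apply: subring1.
  apply: ideal_mul_sub; first exact: local_submod lA.
  by move=> x y Ix Jy; apply: contrapT => hn; apply: h; exists x, y.
have prodA x y : I x -> J y -> A (x * y).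
  by move=> Ix Jy; rewrite -[X in X _]eA; apply: mem_ideal_mul.
have ij0 : i * j != 0.
  by apply: contra_notN nM => /eqP ->; exact: submodule0 (local_submod lA).
have Ai := local_unit lA (prodA _ _ Ii Jj) nM.
move: (ij0); rewrite mulf_eq0 negb_or => /andP[i0 j0].
exists i => //; apply/seteqP; split=> z; rewrite /scale /=.
- move=> Iz; rewrite (_ : z / i = z * j * (i * j)^-1).
    by apply: subringM => //; apply: prodA.
  by field; rewrite i0 j0.
- by move=> h; rewrite -(divfK i0 z); exact: (submoduleZ sI).
Qed.
End InvertibleIdeals.

(** * Local domains whose nonzero ideals are principal or multiples of one ideal *)

Section PinchedDomains.
Variable K : fieldType.
Implicit Types (A B C I J M N X Q : set K) (x y z a b p m s t : K).

(** What is left of the MPD condition in a local domain once invertible ideals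
    are known to be principal. The field [pin_all] keeps [A x], which comes from
    [J] being an integral ideal in [I = J Q]: without it the local ring of
    a node would qualify. *)
Record pinched A M Q : Prop := Pinched {
  pin_local : local_domain A M;
  pin_ideal : is_ideal A Q;
  pin_nonprincipal : ~ principal A Q;
  pin_max : forall I, is_ideal A I -> Q `<=` I -> I = Q \/ principal A I;
  pin_all : forall I, is_ideal A I -> I <> [set 0] ->
    principal A I \/ exists x, [/\ A x, x != 0 & I = scale x Q] }.

Lemma pinched_of_MPD A M : local_domain A M -> is_MPD A ->
  exists Q, pinched A M Q.
Proof.
move=> lA [Q [eQ h]]; have rA := local_subring lA.
have [iQ nQ mQ] : is_MNI A Q by have : [set Q] Q by []; rewrite -eQ.
exists Q; split=> //.
- by move/(principal_invertible rA iQ).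
- move=> I iI QI; have [pI|npI] := pselect (principal A I); first by right.
  by left; apply: mQ => // /(invertible_principal lA iI).
- move=> I iI I0; have [pI|npI] := pselect (principal A I); first by left.
  right; have nI : ~ is_invertible A I by move/(invertible_principal lA iI).
  have [J [iJ vJ ->]] := h _ iI I0 nI.
  have [x x0 eJ] := invertible_principal lA iJ vJ.
  exists x; split=> //; first by apply: iJ.2; rewrite eJ; apply: scale_id.
  by rewrite eJ ideal_mul_scale //; apply: iQ.1.
Qed.

Lemma pin_sub A M Q : pinched A M Q -> Q `<=` M.
Proof.
move=> pA z Qz; apply: contrapT => nMz; have lA := pin_local pA.
have iQ := pin_ideal pA; apply: (pin_nonprincipal pA); exists 1.
  exact: oner_neq0.
rewrite scale1; apply: ideal_unit => //.
have z0 : z != 0.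
  by apply: contra_notN nMz => /eqP ->; exact: submodule0 (local_submod lA).
rewrite -(mulVf z0); apply: (submoduleZ iQ.1) => //.
by apply: (local_unit lA) => //; apply: iQ.2.
Qed.

(** If [x] generates [I] then [x / p] is a multiple of [x], making [p] a unit. *)
Lemma divisible_nonprincipal A M I p : local_domain A M -> M p -> p != 0 ->
  (forall z, I z -> I (z / p)) -> ~ principal A I.
Proof.
move=> lA Mp p0 h [x x0 eI]; apply: (local_nonunit lA Mp p0).
have : I (x / p) by apply: h; rewrite eI; apply: scale_id (local_subring lA) x0.
by rewrite eI /scale /= mulrAC divff // mul1r.
Qed.

(** [N] is not principal, so it is [x Q], and dividing [x z] by [m] inside [N]
    divides [z] inside [Q]. *)
Lemma pin_div_closed A M Q N m : pinched A M Q -> is_ideal A N ->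
  N <> [set 0] -> M m -> m != 0 -> (forall z, N z -> N (z / m)) ->
  forall z, Q z -> Q (z / m).
Proof.
move=> pA iN N0 Mm m0 h z Qz.
have [pN|[x [Ax x0 eN]]] := pin_all pA iN N0.
  by case: (divisible_nonprincipal (pin_local pA) Mm m0 h).
have : N (x * z) by rewrite eN; apply: scale_mem.
move/h; rewrite eN /scale /= (_ : x * z / m / x = z / m) //.
by field; rewrite m0 x0.
Qed.

Definition infinitely_divisible A m : set K :=
  [set y | forall n, A (y / m ^+ n)].

Lemma infinitely_divisible_ideal A m : is_subring A ->
  is_ideal A (infinitely_divisible A m).
Proof.
move=> rA; split; last by move=> y /(_ 0); rewrite expr0 divr1.
split=> [n|x y hx hy n|a x Aa hx n].
- by rewrite mul0r; apply: subring0.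
- by rewrite mulrDl; apply: subringD.
- by rewrite -mulrA; apply: subringM.
Qed.

Lemma infinitely_divisible_div A m z : infinitely_divisible A m z ->
  infinitely_divisible A m (z / m).
Proof. by move=> h n; have := h n.+1; rewrite exprS invfM mulrA. Qed.

(** A nonzero ideal of common multiples of the powers of [m] would let
    [pin_div_closed] put [m / m] in [Q]. *)
Lemma pin_separated A M Q m : pinched A M Q -> Q m -> m != 0 ->
  forall y, (forall n, A (y / m ^+ n)) -> y = 0.
Proof.
move=> pA Qm m0 y hy; have lA := pin_local pA.
apply/eqP/negPn/negP => y0; have Mm := pin_sub pA Qm.
have : Q (m / m).
  apply: (pin_div_closed pA _ _ Mm m0) (Qm).
  - apply: infinitely_divisible_ideal m (local_subring lA).
  - exact: (@nonzero_set _ _ y).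
  - by move=> z; apply: infinitely_divisible_div.
rewrite divff // => /(pin_sub pA); exact: local_proper lA.
Qed.

(** The ideal [p^-1 Q] contains [Q] and is principal only if [Q] is, so it is
    [Q] by maximality. *)
Lemma pin_generator_div A M Q p : pinched A M Q -> p != 0 -> M = scale p A ->
  forall z, Q z -> Q (z / p).
Proof.
move=> pA p0 eM z Qz; have [sQ QA] := pin_ideal pA; have lA := pin_local pA.
have rA := local_subring lA.
have Mp : M p by rewrite eM; apply: scale_id.
pose I := [set y | Q (p * y)].
have iI : is_ideal A I.
  split; last first.
    move=> y /(pin_sub pA); rewrite eM /scale /= mulrAC divff // mul1r //.
  split; rewrite /I /=.
  - by rewrite mulr0; apply: submodule0 sQ.
  - by move=> x y; rewrite mulrDr; apply: submoduleD sQ.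
  - by move=> a x Aa Ix; rewrite mulrCA; apply: (submoduleZ sQ).
have QI : Q `<=` I.
  by move=> y Qy; apply: (submoduleZ sQ) => //; apply: local_sub lA _ Mp.
suff eI : I = Q by rewrite -eI /I /= mulrC divfK.
have [//|[x x0 eI]] := pin_max pA iI QI.
case: (pin_nonprincipal pA); exists (p * x); first by rewrite mulf_neq0.
apply/seteqP; split=> y; rewrite /scale /=.
- move=> Qy; have : I (y / p) by rewrite /I /= mulrC divfK.
  by rewrite eI /scale /= invfM mulrA.
- move=> h; have : I (y / p) by rewrite eI /scale /= -mulrA -invfM.
  by rewrite /I /= mulrC divfK.
Qed.

Lemma pin_max_cases A M Q : pinched A M Q -> M = Q \/ principal A M.
Proof.
move=> pA; apply: (pin_max pA); last exact: pin_sub pA.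
exact: local_idealP (pin_local pA).
Qed.

(** * Pinched domains that are not valuation domains *)

(** Take [x = a / b] with neither [x] nor [x^-1] in [A]. The ideal generated by
    [a] and [b] is not principal, so it is a multiple of [Q]. *)
Lemma pin_two_gen A M Q : pinched A M Q -> ~ is_valuation_domain A ->
  exists a b, [/\ A a, A b, gen2 A a b <> [set 0] & Q = gen2 A a b].
Proof.
move=> pA nv; have lA := pin_local pA; have rA := local_subring lA.
have [x [x0 nAx nAx']] : exists x, [/\ x != 0, ~ A x & ~ A x^-1].
  apply: contrapT => h; apply: nv => x x0.
  have [Ax|nAx] := pselect (A x); [by left|right].
  by apply: contrapT => nAx'; apply: h; exists x.
have [a [b [Aa Ab b0 e]]] := local_frac x lA.
have iI := gen2_ideal rA Aa Ab.
have I0 : gen2 A a b <> [set 0] by apply: nonzero_set b0 _; exact: gen2_r.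
have [[z z0 eI]|[z [Az z0 eI]]] := pin_all pA iI I0.
  have [[a0 {}eI]|[_ {}eI]] := gen2_principal lA z0 eI.
  - have : gen2 A a b b by apply: gen2_r.
    by rewrite eI /scale /= -invf_div -e.
  - have : gen2 A a b a by apply: gen2_l.
    by rewrite eI /scale /= -e.
have QI y : Q y = gen2 A a b (z * y).
  by rewrite eI /scale /= mulrAC divff // mul1r.
exists (a / z), (b / z).
have eQ : Q = gen2 A (a / z) (b / z).
  apply/seteqP; split=> y; rewrite QI => -[c [d [Ac Ad ey]]].
  - exists c, d; split=> //; apply: (mulfI z0); rewrite ey.
    by field; rewrite z0.
  - by exists c, d; split=> //; rewrite ey; field; rewrite z0.
have QA := (pin_ideal pA).2.
split=> //.
- by apply: QA; rewrite QI mulrC divfK //; apply: gen2_l.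
- by apply: QA; rewrite QI mulrC divfK //; apply: gen2_r.
- apply: (@nonzero_set _ _ (b / z)); last exact: gen2_r.
  by rewrite mulf_neq0 ?invr_neq0.
Qed.

(** Otherwise [M = p A], hence [Q = p Q] with [Q] finitely generated, and
    Nakayama's lemma makes [Q] principal. *)
Lemma pin_max_two_gen A M Q : pinched A M Q -> ~ is_valuation_domain A ->
  M = Q.
Proof.
move=> pA nv; have [a [b [Aa Ab nz eQ]]] := pin_two_gen pA nv.
have [//|[p p0 eM]] := pin_max_cases pA; have lA := pin_local pA.
case: (pin_nonprincipal pA); rewrite eQ; apply: (nakayama2 lA nz) => z.
rewrite -eQ => /(pin_generator_div pA p0 eM); rewrite eQ => -[c [d [Ac Ad e]]].
exists (p * c), (p * d); split.
- by rewrite eM; apply: scale_mem.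
- by rewrite eM; apply: scale_mem.
- by rewrite -!mulrA -mulrDr -e mulrC divfK.
Qed.

(** The square of [M] is [x A] or [x M]. In the first case [M] is invertible,
    hence principal; in the second [x] is in [M], as otherwise [M] would equal
    its square and Nakayama's lemma would apply. *)
Lemma pin_square A M Q : pinched A M Q -> ~ is_valuation_domain A ->
  exists x, [/\ x != 0, M x & forall y z, M y -> M z -> M (y * z / x)].
Proof.
move=> pA nv; have lA := pin_local pA; have rA := local_subring lA.
have sM := local_submod lA; have MA := local_sub lA.
have eMQ := pin_max_two_gen pA nv.
have npM : ~ principal A M by rewrite eMQ; exact: pin_nonprincipal pA.
have [a [b [Aa Ab nz eQ]]] := pin_two_gen pA nv.
have eM : M = gen2 A a b by rewrite eMQ.
have Ma : M a by rewrite eM; apply: gen2_l.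
have Mb : M b by rewrite eM; apply: gen2_r.
pose S := [set z | exists c d, [/\ M c, M d & z = c * a + d * b]].
have MS y z : M y -> M z -> S (y * z).
  move=> My; rewrite eM => -[c [d [Ac Ad ->]]].
  exists (c * y), (d * y); split; [exact: submoduleZ sM Ac My|
    exact: submoduleZ sM Ad My|ring].
have iS : is_ideal A S.
  split; last first.
    move=> _ [c [d [Mc Md ->]]].
    by apply: subringD => //; apply: subringM => //; apply: MA.
  split.
  - by exists 0, 0; rewrite !mul0r addr0; split=> //; apply: submodule0 sM.
  - move=> _ _ [c [d [Mc Md ->]]] [c' [d' [Mc' Md' ->]]].
    by exists (c + c'), (d + d'); split; [apply: (submoduleD sM)..|ring].
  - move=> e _ Ae [c [d [Mc Md ->]]].
    by exists (e * c), (e * d); split; [apply: (submoduleZ sM)..|ring].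
have S0 : S <> [set 0].
  rewrite eM in sM; have [y y0] := nonzero_elt sM nz; rewrite -eM => My.
  by apply: (@nonzero_set _ _ (y * y)); [rewrite mulf_neq0|apply: MS].
have [[x x0 eS]|[x [Ax x0 eS]]] := pin_all pA iS S0.
- case: npM; have Sx : S x by rewrite eS; apply: scale_id.
  have SA y z : M y -> M z -> A (y * z / x).
    by move=> My Mz; have := MS _ _ My Mz; rewrite eS.
  have key c d : M c -> M d -> ~ M (c * d / x) -> principal A M.
    move=> Mc Md nM; have Aw := local_unit lA (SA _ _ Mc Md) nM.
    have : c * d / x != 0.
      by apply: contra_notN nM => /eqP ->; exact: submodule0 sM.
    rewrite !mulf_eq0 !negb_or => /andP[/andP[c0 d0] _].
    exists d => //; apply/seteqP; split=> z; rewrite /scale /=.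
    + move=> Mz; rewrite (_ : z / d = c * z / x * (c * d / x)^-1).
        by apply: subringM => //; apply: SA.
      by field; rewrite x0 c0 d0.
    + by move=> h; rewrite -(divfK d0 z); apply: (submoduleZ sM).
  have [c [d [Mc Md e]]] := Sx.
  have : ~ M (c * a / x + d * b / x).
    by rewrite -mulrDl -e divff //; apply: local_proper lA.
  by move/(local_unit_sum lA) => [] /key; apply.
- exists x; split=> //.
    apply: contrapT => nMx; apply: npM; rewrite eM.
    apply: (nakayama2 lA nz) => z; rewrite -eM => Mz.
    suff : S z by [].
    rewrite eS -eMQ /scale /= mulrC; apply: (submoduleZ sM) => //.
    exact: (local_unit lA).
  by move=> y z My Mz; have := MS _ _ My Mz; rewrite eS -eMQ.
Qed.

End PinchedDomains.

(** * The multiplier ring of a pinched domain that is not a valuation domain *)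

Section PinchedOverrings.
Variable K : fieldType.
Implicit Types (A B C I J M N X Q W : set K) (x y z a b p m s t : K).

(** The ring of multipliers [(M : M)], when [M] is [x (M : M)]. *)
Definition conductor_ring M x : set K := [set y | M (x * y)].

Section Conductor.
Variables (A M Q : set K) (x : K).
Hypothesis (pA : pinched A M Q) (nv : ~ is_valuation_domain A).
Hypotheses (x0 : x != 0) (Mx : M x)
  (Mxx : forall y z, M y -> M z -> M (y * z / x)).
Let lA := pin_local pA.
Let rA := local_subring lA.
Let sM := local_submod lA.
Let MA := local_sub lA.
Let eMQ := pin_max_two_gen pA nv.
Let B := conductor_ring M x.

Lemma conductor_mul y m : B y -> M m -> M (y * m).
Proof.
move=> By Mm; rewrite (_ : y * m = x * y * m / x); first exact: Mxx.
by field; rewrite x0.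
Qed.

Lemma conductor_max : M = scale x B.
Proof.
by apply/seteqP; split=> z; rewrite /scale /B /conductor_ring /= mulrC divfK.
Qed.

Lemma conductor_sub : A `<=` B.
Proof. by move=> y Ay; rewrite /B /conductor_ring /= mulrC; apply: (submoduleZ sM). Qed.

Lemma conductor_subring : is_subring B.
Proof.
apply: is_subringP.
- by apply: conductor_sub; apply: subring1.
- move=> y z By Bz; rewrite /B /conductor_ring /= mulrBr -[- _]mulN1r.
  apply: (submoduleD sM) => //; apply: (submoduleZ sM) => //.
  by apply: subringN => //; apply: subring1.
- move=> y z By Bz; rewrite /B /conductor_ring /= mulrCA.
  by apply: conductor_mul.
Qed.

Lemma max_nonprincipal : ~ principal A M.
Proof. by rewrite eMQ; apply: pin_nonprincipal pA. Qed.

(** For [y] in [B] outside [M] the ideal [y M] is not principal, so it is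
    [y' M] with [y'] in [A]; as [y'] cannot lie in [M], it is a unit of [A]. *)
Lemma conductor_unit y : B y -> ~ M y -> B y^-1.
Proof.
move=> By nMy; have y0 : y != 0.
  by apply: contra_notN nMy => /eqP ->; exact: submodule0 sM.
have iI : is_ideal A (scale y M).
  split; first exact: scale_submodule.
  move=> z h; rewrite -(divfK y0 z) mulrC; apply: MA; exact: conductor_mul.
have Iyx : scale y M (y * x) by apply: scale_mem.
have I0 : scale y M <> [set 0].
  by apply: nonzero_set Iyx; rewrite mulf_neq0.
have [[w w0 eI]|[w [Aw w0 eI]]] := pin_all pA iI I0.
  case: max_nonprincipal; exists (w / y); first by rewrite mulf_neq0 ?invr_neq0.
  apply/seteqP; split=> z; rewrite /scale /=.
  - move=> Mz; have : scale y M (y * z) by apply: scale_mem.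
    by rewrite eI /scale /= invf_div mulrA (mulrC z).
  - rewrite invf_div mulrA (mulrC z) => h.
    have : scale y M (y * z) by rewrite eI.
    by rewrite /scale /= mulrAC divff // mul1r.
rewrite -eMQ in eI.
have nMw : ~ M w.
  move=> Mw; apply: nMy; rewrite (_ : y = (y * x / w) * w / x); last first.
    by field; rewrite w0 x0.
  by apply: Mxx => //; rewrite eI in Iyx.
have h : M (w * x / y).
  have : scale w M (w * x) by apply: scale_mem.
  by rewrite -eI.
rewrite /B /conductor_ring /= (_ : x / y = w^-1 * (w * x / y)).
  by apply: (submoduleZ sM) => //; apply: (local_unit lA).
by field; rewrite w0 y0.
Qed.

Lemma conductor_local : local_domain B M.
Proof.
split.
- split; first exact: conductor_subring.
  move=> y; have [a [b [Aa Ab b0 e]]] := local_frac y lA.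
  by exists a, b; split=> //; apply: conductor_sub.
- split; last by move=> y /MA /conductor_sub.
  split; [exact: submodule0 sM|by move=> y z; apply: (submoduleD sM)|].
  exact: conductor_mul.
- exact: local_proper lA.
- exact: conductor_unit.
Qed.

Lemma conductor_uniformizer : uniformizer B M x.
Proof.
split=> //; first exact: conductor_max.
move=> y hy; apply: (pin_separated pA (m := x)) => //; first by rewrite -eMQ.
move=> n; apply: MA; have := hy n.+1; rewrite /B /conductor_ring /=.
rewrite (_ : _ * _ = y / x ^+ n) // exprS.
by field; rewrite x0 expf_neq0.
Qed.

Lemma conductor_valuation : is_valuation_domain B.
Proof. exact: uniformizer_valuation conductor_local conductor_uniformizer. Qed.

(** [M] is the maximal ideal of the valuation domain [B]. *)
Lemma conductor_strong y z : M (y * z) -> M y \/ M z.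
Proof.
move=> Myz; have [My|nMy] := pselect (M y); [by left|right].
have y0 : y != 0.
  by apply: contra_notN nMy => /eqP ->; exact: submodule0 sM.
rewrite -(mulKf y0 z); apply: conductor_mul => //.
have [By|//] := conductor_valuation y0.
exact: (local_unit conductor_local By nMy).
Qed.

(** For [C] inside [B] the ideal [x C] of [A] is [y A] or [y M]; in the first
    case [C] is a principal [A]-module and a ring, so it is [A]. *)
Lemma conductor_overrings C : is_subring C -> A `<=` C ->
  [\/ C = A, C = B | C = setT].
Proof.
move=> rC AC; have [CB|nCB] := pselect (C `<=` B); last first.
  apply: Or33; have [z [Cz nBz]] : exists z, C z /\ ~ B z.
    by apply: contrapT => h; apply: nCB => z Cz; apply: contrapT => nBz;
      apply: h; exists z.
  have Mm := local_valuation_max conductor_local conductor_valuation nBz.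
  have z0 : z != 0.
    by apply: contra_notN nBz => /eqP ->; exact: subring0 conductor_subring.
  have BC : B `<=` C.
    move=> b Bb; rewrite -(divfK z0 b); apply: subringM => //.
    by apply: AC; apply: MA; apply: conductor_mul.
  apply: (overring_full rC BC conductor_valuation (m := z^-1)).
  - by rewrite invr_eq0.
  - by rewrite invrK.
  - move=> y hy; apply: (pin_separated pA (m := z^-1)).
    + by rewrite -eMQ.
    + by rewrite invr_eq0.
    + move=> n; apply: MA; rewrite [X in M X](_ : _ = (y / z^-1 ^+ n.+1) * z^-1).
        exact: conductor_mul.
      have : z^-1 != 0 by rewrite invr_eq0.
      by move: (z^-1) => w w0; rewrite exprS; field; rewrite w0 expf_neq0.
have sAC : is_submodule A C.
  split; [exact: subring0|by move=> *; apply: subringD|].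
  by move=> a c Aa Cc; apply: subringM => //; apply: AC.
have iI : is_ideal A (scale x C).
  split; first exact: scale_submodule.
  by move=> z /CB; rewrite /B /conductor_ring /= mulrC divfK // => /MA.
have I0 : scale x C <> [set 0] by apply: nonzero_set x0 _; exact: scale_id.
have C1 := subring1 rC.
have unscale y N : y != 0 -> scale x C = scale y N -> C = scale (y / x) N.
  move=> y0 e; apply/seteqP; split=> z; rewrite /scale /=.
  - move=> Cz; have : scale x C (x * z) by apply: scale_mem.
    by rewrite e /scale /= invf_div mulrA (mulrC z).
  - rewrite invf_div mulrA (mulrC z) => h.
    have : scale x C (x * z) by rewrite e.
    by rewrite /scale /= mulrAC divff // mul1r.
have [[y y0 /(unscale _ _ y0)]|[y [_ y0 /(unscale _ _ y0)]]] := pin_all pA iI I0.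
- set w := y / x => eC; have w0 : w != 0 by rewrite mulf_neq0 ?invr_neq0.
  have Cw : C w by rewrite eC; apply: scale_id.
  have Aw' : A w^-1 by move: (C1); rewrite eC /scale /= div1r.
  have Aw : A w.
    have : C (w * w) by apply: subringM.
    by rewrite [X in X _]eC /scale /= mulfK.
  apply: Or31; rewrite eC -[RHS]scale1; apply: scale_associate => //.
  + exact: oner_neq0.
  + by rewrite divr1.
  + by rewrite div1r.
- set w := y / x => eC; have w0 : w != 0 by rewrite mulf_neq0 ?invr_neq0.
  apply: Or32; apply/seteqP; split=> // b Bb; rewrite eC /scale /= -eMQ.
  apply: conductor_mul => //.
  by move: C1; rewrite eC /scale /= div1r eMQ.
Qed.

Lemma conductor_neq : B <> A.
Proof.
by move=> e; apply: max_nonprincipal; rewrite -e; exists x => //; exact: conductor_max.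
Qed.

Lemma conductor_neqT : B <> setT.
Proof.
move=> e; have : B x^-1 by rewrite e.
by rewrite /B /conductor_ring /= divff // => /(local_proper lA).
Qed.

End Conductor.

(** * Pinched valuation domains of rank two *)

(** The ring [A [p^-1]]. *)
Definition invert A p : set K := [set y | exists n, A (y * p ^+ n)].

Section RankTwo.
Variables (A M Q : set K) (p s : K).
Hypothesis (pA : pinched A M Q) (vA : is_valuation_domain A).
Hypotheses (p0 : p != 0) (eM : M = scale p A).
Hypotheses (s0 : s != 0) (hs : infinitely_divisible A p s).
Let lA := pin_local pA.
Let rA := local_subring lA.
Let sM := local_submod lA.
Let MA := local_sub lA.
Let W := invert A p.

Let Mp : M p.
Proof. by rewrite eM; apply: scale_id. Qed.

(** [Q] is [p]-divisible, hence contained in the right-hand side; that ideal is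
    not principal, so the maximality of [Q] gives equality. *)
Lemma rank_two_pin : Q = infinitely_divisible A p.
Proof.
have QN : Q `<=` infinitely_divisible A p.
  move=> z Qz n; apply: (pin_ideal pA).2; elim: n => [|n IHn].
    by rewrite expr0 divr1.
  by rewrite exprSr invfM mulrA; apply: (pin_generator_div pA p0 eM).
have [//|] := pin_max pA (infinitely_divisible_ideal p rA) QN.
by move/(divisible_nonprincipal lA Mp p0 (@infinitely_divisible_div _ A p)).
Qed.

Lemma invert_subring : is_subring W.
Proof.
have Ap n : A (p ^+ n) by apply: subringX => //; apply: MA.
apply: is_subringP.
- by exists 0; rewrite expr0 mulr1; apply: subring1.
- move=> y z [n hn] [k hk]; exists (n + k)%N; rewrite mulrBl; apply: subringB => //.
    by rewrite exprD mulrA; apply: subringM.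
  by rewrite addnC exprD mulrA; apply: subringM.
- move=> y z [n hn] [k hk]; exists (n + k)%N; rewrite exprD mulrACA.
  exact: subringM.
Qed.

Lemma invert_sub : A `<=` W.
Proof. by move=> y Ay; exists 0; rewrite expr0 mulr1. Qed.

(** [s W] is a [p]-divisible nonzero ideal of [A], so it is a multiple [x Q]. *)
Lemma rank_two_uniformizer : exists2 t, t != 0 & Q = scale t W.
Proof.
pose I := scale s W.
have IQ : I `<=` Q.
  move=> z [n hn]; rewrite rank_two_pin => k.
  rewrite (_ : z / p ^+ k = z / s * p ^+ n * (s / p ^+ (n + k))).
    by apply: subringM.
  by rewrite exprD; field; rewrite s0 !expf_neq0.
have sWA : is_submodule A W.
  split; [exact: subring0 invert_subring|by move=> *; apply: (subringD invert_subring)|].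
  by move=> a z Aa Wz; apply: (subringM invert_subring) => //; exact: invert_sub.
have iI : is_ideal A I.
  by split; [exact: scale_submodule|move=> z /IQ; apply: (pin_ideal pA).2].
have I0 : I <> [set 0] by apply: nonzero_set s0 _; exact: scale_id invert_subring s0.
have Idiv z : I z -> I (z / p).
  move=> [n hn]; exists n.+1; rewrite exprS.
  rewrite (_ : _ * _ = z / s * p ^+ n) //; by field; rewrite s0 p0.
have [/(divisible_nonprincipal lA Mp p0 Idiv)//|[x [Ax x0 eI]]] := pin_all pA iI I0.
exists (s / x); first by rewrite mulf_neq0 ?invr_neq0.
apply/seteqP; split=> z; rewrite /scale /= invf_div mulrA (mulrC z) => h.
- by have : I (x * z) by rewrite eI; exact: scale_mem.
- have : I (x * z) by [].
  by rewrite eI /scale /= mulrAC divff // mul1r.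
Qed.

(** As [w] is a unit of [W], the powers of [p] dividing [w p ^ n] are bounded;
    the largest of them leaves a unit of [A]. *)
Lemma rank_two_order w : w != 0 -> W w -> W w^-1 ->
  exists k : int, A (w / p ^ k) /\ A (p ^ k / w).
Proof.
move=> w0 [n hn] [k hk]; have pn n' := expf_neq0 n' p0.
have [l [h1 h2]] : exists l : nat,
    A (w * p ^+ n / p ^+ l) /\ A (p ^+ l / (w * p ^+ n)).
  apply: (order_of_vanishing lA) => //; exists (n + k).+1 => h.
  apply: (local_nonunit lA Mp p0).
  rewrite (_ : p^-1 = (w * p ^+ n / p ^+ (n + k).+1) * (w^-1 * p ^+ k)).
    exact: subringM.
  by rewrite exprS exprD; field; rewrite w0 p0 !pn.
exists (l%:Z - n%:Z); rewrite expfzDr // -invr_expz -!exprnP.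
split.
- by rewrite [X in A X](_ : _ = w * p ^+ n / p ^+ l) //; field; rewrite !pn.
- by rewrite [X in A X](_ : _ = p ^+ l / (w * p ^+ n)) //; field; rewrite !pn w0.
Qed.

Lemma rank_two_local : local_domain W Q.
Proof.
split.
- split; first exact: invert_subring.
  move=> y; have [a [b [Aa Ab b0 e]]] := local_frac y lA.
  by exists a, b; split=> //; apply: invert_sub.
- split; last by move=> z /(pin_ideal pA).2; apply: invert_sub.
  have sQ := (pin_ideal pA).1.
  split; [exact: submodule0 sQ|by move=> y z; apply: (submoduleD sQ)|].
  move=> y z [n hn]; rewrite rank_two_pin => hz k.
  rewrite (_ : y * z / p ^+ k = (y * p ^+ n) * (z / p ^+ (n + k))).
    exact: subringM.
  by rewrite exprD; field; rewrite !expf_neq0.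
- by move/(pin_sub pA); apply: local_proper lA.
- move=> y [n hn] nQy.
  have [k nk] : exists k, ~ A (y / p ^+ k).
    apply: contrapT => h; apply: nQy; rewrite rank_two_pin => k.
    by apply: contrapT => hk; apply: h; exists k.
  have y0 : y != 0.
    by apply: contra_notN nk => /eqP ->; rewrite mul0r; apply: subring0.
  have yk0 : y / p ^+ k != 0 by rewrite mulf_neq0 ?invr_neq0 ?expf_neq0.
  exists k; have [/nk //|] := vA yk0.
  by rewrite invf_div mulrC.
Qed.

Lemma rank_two_separated t : t != 0 -> Q = scale t W -> uniformizer W Q t.
Proof.
move=> t0 eQ; split=> // y hy.
have Qt : Q t by rewrite eQ; apply: scale_id invert_subring t0.
apply: (pin_separated pA Qt t0) => n; apply: (pin_ideal pA).2.
by rewrite eQ; have := hy n.+1; rewrite /scale /= exprSr invfM mulrA.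
Qed.

Lemma rank_two_overrings C : is_subring C -> A `<=` C ->
  [\/ C = A, C = W | C = setT].
Proof.
move=> rC AC; have [CA|nCA] := pselect (C `<=` A).
  by apply: Or31; apply/seteqP.
have [z [Cz nAz]] : exists z, C z /\ ~ A z.
  by apply: contrapT => h; apply: nCA => z Cz; apply: contrapT => nAz;
    apply: h; exists z.
have Cp : C p^-1.
  have := local_valuation_max lA vA nAz; rewrite eM /scale /= => h.
  have z0 : z != 0.
    by apply: contra_notN nAz => /eqP ->; exact: subring0.
  rewrite -(mulVKf z0 p^-1) ; apply: subringM => //.
  exact: AC.
have WC : W `<=` C.
  move=> y [n hn]; rewrite -(mulfK (expf_neq0 n p0) y) -exprVn.
  by apply: subringM => //; [exact: AC|exact: subringX].
have [CW|nCW] := pselect (C `<=` W).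
  by apply: Or32; apply/seteqP.
have {z Cz nAz} [z [Cz nWz]] : exists z, C z /\ ~ W z.
  by apply: contrapT => h; apply: nCW => y Cy; apply: contrapT => nWy;
    apply: h; exists y.
have [t t0 eQ] := rank_two_uniformizer.
have vW := uniformizer_valuation rank_two_local (rank_two_separated t0 eQ).
have Qz := local_valuation_max rank_two_local vW nWz.
have z0 : z != 0.
  by apply: contra_notN nWz => /eqP ->; exact: subring0 invert_subring.
apply: Or33; apply: (overring_full rC AC vA (m := z^-1)).
- by rewrite invr_eq0.
- by rewrite invrK.
- by apply: (pin_separated pA) => //; rewrite invr_eq0.
Qed.

Lemma invert_neq : W <> A.
Proof.
move=> e; apply: (local_nonunit lA Mp p0); rewrite -e.
by exists 1; rewrite expr1 mulVf //; apply: subring1.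
Qed.

Lemma invert_neqT : W <> setT.
Proof.
move=> e; have [t t0 eQ] := rank_two_uniformizer.
apply: (local_proper lA); apply: (pin_sub pA); rewrite eQ /scale /=.
by rewrite -/W e.
Qed.

End RankTwo.

End PinchedOverrings.

(** * The four local types and their ring-theoretic description *)

Section LocalTypes.
Variable K : fieldType.
Implicit Types (A B C I J M N X Q W : set K) (x y z a b p m s t : K).

(** The types of valuation domains are told apart by the generators of [M], so
    that their exclusivity needs no comparison of value groups. *)
Definition nondiscrete A M : Prop := is_valuation_domain A /\ ~ principal A M.

Definition rank_two A M : Prop :=
  is_valuation_domain A /\
  exists p, [/\ p != 0, M = scale p A & infinitely_divisible A p <> [set 0]].

Definition discrete A M : Prop := exists p, uniformizer A M p.

Lemma infinitely_divisible0 A p : is_subring A ->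
  infinitely_divisible A p = [set 0] <->
  (forall y, (forall n, A (y / p ^+ n)) -> y = 0).
Proof.
move=> rA; split=> [e y hy|h].
  by have : infinitely_divisible A p y by []; rewrite e.
apply/seteqP; split=> y; first by move/h.
by move=> -> n; rewrite mul0r; apply: subring0.
Qed.

Lemma valuation_types A M : local_domain A M -> is_valuation_domain A ->
  [\/ nondiscrete A M, rank_two A M | discrete A M].
Proof.
move=> lA vA; have [[p p0 eM]|npM] := pselect (principal A M); last by apply: Or31.
have [e|ne] := pselect (infinitely_divisible A p = [set 0]); last first.
  by apply: Or32; split=> //; exists p.
apply: Or33; exists p; split=> //.
exact/(infinitely_divisible0 p (local_subring lA)).
Qed.

Lemma discrete_not_rank_two A M : local_domain A M -> discrete A M ->
  ~ rank_two A M.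
Proof.
move=> lA [p [p0 eM sep]] [_ [q [q0 eM' []]]]; have rA := local_subring lA.
apply/(infinitely_divisible0 q rA) => y hy; apply: sep => n.
have Mq : M q by rewrite eM'; apply: scale_id.
have Aqp : A (q / p) by move: Mq; rewrite eM.
rewrite (_ : y / p ^+ n = y / q ^+ n * (q / p) ^+ n).
  by apply: subringM => //; apply: subringX.
by rewrite expr_div_n mulrA divfK // expf_neq0.
Qed.

Lemma discrete_principal A M : discrete A M -> principal A M.
Proof. by case=> p [p0 eM _]; exists p. Qed.

Lemma rank_two_principal A M : rank_two A M -> principal A M.
Proof. by case=> _ [p [p0 eM _]]; exists p. Qed.

Lemma valuation_max_divisor A X : is_subring A -> is_valuation_domain A ->
  finite_set X -> (exists2 x, X x & x != 0) ->
  exists x, [/\ X x, x != 0 & X `<=` scale x A].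
Proof.
move=> rA vA /finite_seqP[s eX]; rewrite {X}eX.
elim: s => [|a s IHs]; first by case=> x /=.
have [[x sx x0] _|h [x]] := pselect (exists2 x, [set` s] x & x != 0).
- have {IHs}[y [sy y0 h]] := IHs (ex_intro2 _ _ x sx x0).
  have [->|a0] := eqVneq a 0.
    exists y; split=> //; first by rewrite /= inE sy orbT.
    move=> z /=; rewrite inE => /orP[/eqP ->|/h//].
    by rewrite /scale /= mul0r; apply: subring0.
  have ay0 : a / y != 0 by rewrite mulf_neq0 ?invr_neq0.
  have [ya|] := vA _ ay0.
    exists y; split=> //; first by rewrite /= inE sy orbT.
    by move=> z /=; rewrite inE => /orP[/eqP ->|/h].
  rewrite invf_div => ya; exists a; split=> //=; first by rewrite inE eqxx.
  move=> z /=; rewrite inE => /orP[/eqP ->|/h]; first exact: scale_id.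
  rewrite /scale /= => zy; rewrite -(divfK y0 z) -mulrA; exact: subringM.
- rewrite /= inE => /orP[/eqP ->|sx] x0; last by case: h; exists x.
  exists a; split=> //=; first by rewrite inE eqxx.
  move=> z /=; rewrite inE => /orP[/eqP ->|sz]; first exact: scale_id.
  suff -> : z = 0 by rewrite /scale /= mul0r; apply: subring0.
  by apply/eqP/negPn/negP => z0; apply: h; exists z.
Qed.

Lemma span_principal A X : is_subring A -> is_valuation_domain A ->
  finite_set X -> span A X <> [set 0] -> principal A (span A X).
Proof.
move=> rA vA fX nz; have [h|h] := pselect (exists2 x, X x & x != 0).
  have [x [Xx x0 XA]] := valuation_max_divisor rA vA fX h.
  exists x => //; apply/seteqP; split.
  - by apply: span_min => //; apply/scale_submodule/is_submodule_self.
  - move=> z hz; rewrite -(divfK x0 z).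
    by apply: (submoduleZ (span_submodule A X) hz); apply: sub_span.
case: nz; apply/seteqP; split=> [|x ->]; last first.
  exact: submodule0 (span_submodule A X).
apply: span_min; first last.
  by move=> x Xx; apply/eqP/negPn/negP => x0; apply: h; exists x.
split=> //= [x y -> ->|a x _ ->]; by rewrite ?addr0 ?mulr0.
Qed.

(** The common multiples of the powers of a generator [p] of [M] form a
    [p]-divisible ideal, which could not be principal if it were nonzero. *)
Lemma PID_discrete A M : local_domain A M -> M <> [set 0] ->
  (forall I, is_ideal A I -> I <> [set 0] -> principal A I) -> discrete A M.
Proof.
move=> lA M0 h; have rA := local_subring lA.
have [p p0 eM] := h _ (local_idealP lA) M0.
exists p; split=> //; apply/(infinitely_divisible0 p rA).
apply: contrapT => /(h _ (infinitely_divisible_ideal p rA)).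
apply: (divisible_nonprincipal lA _ p0 (@infinitely_divisible_div _ A p)).
by rewrite eM; apply: scale_id.
Qed.

Lemma discrete_DVR A M : local_domain A M -> discrete A M -> is_DVR A.
Proof.
move=> lA [p uA]; have rA := local_subring lA; have [p0 eM _] := uA.
split; first exact: uniformizer_valuation lA uA.
have Mp : M p by rewrite eM; apply: scale_id.
have Ap := local_sub lA Mp.
have posA (k : int) : A (p ^ k) <-> 0 <= k.
  case: k => n; first by split=> // _; rewrite -exprnP; apply: subringX.
  rewrite NegzE; split=> //; rewrite -invr_expz -exprnP => h.
  case: (local_nonunit lA Mp p0); rewrite (_ : p^-1 = (p ^+ n.+1)^-1 * p ^+ n).
    by apply: subringM => //; apply: subringX.
  by rewrite exprS invfM -mulrA mulVf ?mulr1 // expf_neq0.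
apply: (value_group_of_section (e := fun k : int => p ^ k)) => //.
- by move=> g h /le_anti.
- by move=> g; rewrite expfz_neq0.
- by move=> g h; rewrite expfzDr.
- move=> g h; rewrite invr_expz -expfzDr // posA subr_ge0; split; exact: id.
- by move=> y; apply: uniformizer_decomp lA uA.
Qed.

Section FromValueGroup.
Variables (A M : set K) (G : zmodType) (le : rel G) (v : K -> G).
Hypothesis lA : local_domain A M.
Hypothesis vM : forall x y, x != 0 -> y != 0 -> v (x * y) = v x + v y.
Hypothesis vle : forall x y, x != 0 -> y != 0 -> le (v x) (v y) <-> A (y / x).

Let v1 : v 1 = 0.
Proof.
have := vM (oner_neq0 K) (oner_neq0 K); rewrite mulr1 => h.
by apply: (addrI (v 1)); rewrite addr0 -h.
Qed.

Lemma value_ge0 x : x != 0 -> le 0 (v x) <-> A x.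
Proof. by move=> x0; rewrite -v1 vle ?oner_neq0 // divr1. Qed.

Lemma value_le0 x : x != 0 -> le (v x) 0 <-> A x^-1.
Proof. by move=> x0; rewrite -v1 vle ?oner_neq0 // div1r. Qed.

Lemma valueX x n : x != 0 -> v (x ^+ n) = v x *+ n.
Proof.
move=> x0; elim: n => [|n IHn]; first by rewrite expr0 v1.
by rewrite exprS mulrS vM ?expf_neq0 // IHn.
Qed.

Lemma value_max x : x != 0 -> le 0 (v x) -> ~ le (v x) 0 -> M x.
Proof.
move=> x0 /(value_ge0 x0) Ax h; apply: (local_nonunitP lA Ax).
by move/(value_le0 x0).
Qed.

Lemma max_value x : x != 0 -> M x -> le 0 (v x) /\ ~ le (v x) 0.
Proof.
move=> x0 Mx; split; first by apply/(value_ge0 x0); apply: local_sub lA _ Mx.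
by move/(value_le0 x0); apply: local_nonunit lA Mx x0.
Qed.

Lemma least_value_generator p : p != 0 -> le 0 (v p) -> ~ le (v p) 0 ->
  (forall g, le 0 g -> ~ le g 0 -> le (v p) g) -> M = scale p A.
Proof.
move=> p0 h1 h2 h3; have Mp := value_max p0 h1 h2.
apply/seteqP; split=> z; rewrite /scale /=.
- move=> Mz; have [->|z0] := eqVneq z 0.
    by rewrite mul0r; apply: subring0 (local_subring lA).
  by apply/vle => //; have [z1 z2] := max_value z0 Mz; apply: h3.
- by move=> h; rewrite -(divfK p0 z); apply: (submoduleZ (local_submod lA)).
Qed.

End FromValueGroup.

Lemma K4_discrete A M : local_domain A M -> in_K4 A -> discrete A M.
Proof.
move=> lA [vA [v [vM vsurj vle]]]; have [p p0 vp] := vsurj 1.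
exists p; split=> //.
  apply: (least_value_generator lA vM vle) => //; rewrite vp /le_int //.
  by move=> g; lia.
move=> y hy; apply/eqP/negPn/negP => y0.
have := hy (`|v y|.+1)%N.
move/(vle _ _ (expf_neq0 _ p0) y0); rewrite (valueX vM) // vp /le_int.
lia.
Qed.

Lemma le_lexi_intE (g h : int * int) :
  le_lexi_int g h = (g.1 < h.1) || ((g.1 == h.1) && (g.2 <= h.2)).
Proof.
rewrite /le_lexi_int Order.ProdLexiOrder.leEprodlexi.
by case: g h => [g1 g2] [h1 h2] /=; case: (ltgtP g1 h1).
Qed.

Lemma K3_rank_two A M : local_domain A M -> in_K3 A -> rank_two A M.
Proof.
move=> lA [vA [v [vM vsurj vle]]]; split=> //.
have [p p0 vp] := vsurj (0, 1); have [t t0 vt] := vsurj (1, 0).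
exists p; split=> //.
  apply: (least_value_generator lA vM vle) => //; rewrite vp ?le_lexi_intE //=.
  by move=> [g1 g2]; rewrite !le_lexi_intE /=; lia.
apply: (@nonzero_set _ _ t) => // n; apply/vle; rewrite ?expf_neq0 //.
rewrite (valueX vM) // vp vt le_lexi_intE.
suff -> : ((0, 1) : int * int) *+ n = (0, n%:Z) by [].
by elim: n => // n IHn; rewrite mulrS IHn; congr (_, _); lia.
Qed.

(** A generator of [M] would have the least positive value. *)
Lemma K2_nondiscrete (R : realType) A M : local_domain A M -> in_K2 R A ->
  nondiscrete A M.
Proof.
move=> lA [vA [v [vM vsurj vle]]]; split=> // -[p p0 eM].
have Mp : M p by rewrite eM; apply: scale_id (local_subring lA) p0.
have [p1 p2] := max_value lA vM vle p0 Mp.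
have [x x0 vx] := vsurj (v p / 2).
have Mx : M x.
  by apply: (value_max lA vM vle) => //; rewrite vx; move: p1 p2; rewrite /le_real; lra.
move: Mx; rewrite eM /scale /= => /(vle _ _ p0 x0); rewrite vx.
by move: p1 p2; rewrite /le_real; lra.
Qed.

(** Finitely generated ideals of a valuation domain are principal, so
    a two-generated one is a DVR, against the definition of the class. *)
Lemma K1_nonvaluation A M : local_domain A M -> M <> [set 0] -> in_K1 A ->
  ~ is_valuation_domain A.
Proof.
move=> lA M0 [tA _ nD] vA; apply: nD; apply: (discrete_DVR lA).
apply: (PID_discrete lA M0) => I iI I0.
have [a [b e]] := tA _ iI; rewrite e; rewrite e in I0.
by apply: span_principal => //; exact: local_subring lA.
Qed.

(** If [x y] is in [P] and [x] is not in [A], then [x^-1] multiplies [M] into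
    [M]; so [y] and [y / x] are in [M], and [y * y = (y / x) * (x * y)] is
    in [P]. *)
Lemma PVD_of_strong_max A M : local_domain A M ->
  (forall x y, M (x * y) -> M x \/ M y) -> is_PVD A.
Proof.
move=> lA sM P [iP nP hP].
have PM := local_maximal_ideal lA iP nP; have MA := local_sub lA.
have key x y : P (x * y) -> ~ A x -> P y.
  move=> Pxy nAx; have x0 : x != 0.
    by apply: contra_notN nAx => /eqP ->; apply: subring0 (local_subring lA).
  have divM m : M m -> M (m / x).
    move=> Mm; have : M (x * (m / x)) by rewrite mulrC divfK.
    by move=> /sM[/MA|].
  have My : M y by rewrite -(mulKf x0 y) mulrC; apply: divM; apply: PM.
  have : P (y * y).
    rewrite (_ : y * y = (y / x) * (x * y)).
      by apply: (submoduleZ iP.1) => //; apply: MA; apply: divM.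
    by field; rewrite x0.
  by move=> /(hP _ _ (MA _ My) (MA _ My))[].
move=> x y Pxy; have [Ax|nAx] := pselect (A x); last by right; apply: key nAx.
have [Ay|nAy] := pselect (A y); first exact: hP.
by left; apply: key nAy; rewrite mulrC.
Qed.

Lemma nonvaluation_two_generated A M Q I : pinched A M Q ->
  ~ is_valuation_domain A -> is_ideal A I -> exists a b, I = gen2 A a b.
Proof.
move=> pA nv iI; have rA := local_subring (pin_local pA).
have [->|I0] := pselect (I = [set 0]); first by exists 0, 0; rewrite gen2_zero.
have [[x x0 ->]|[x [_ x0 ->]]] := pin_all pA iI I0.
  by exists x, x; rewrite gen2_scale.
have [a [b [_ _ _ ->]]] := pin_two_gen pA nv.
exists (x * a), (x * b); apply/seteqP; split=> z; rewrite /scale /=.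
- move=> [c [d [Ac Ad e]]]; exists c, d; split=> //.
  by rewrite -(divfK x0 z) e; ring.
- move=> [c [d [Ac Ad ->]]]; exists c, d; split=> //.
  by field; rewrite x0.
Qed.

Lemma nonvaluation_K1 A M Q : pinched A M Q -> ~ is_valuation_domain A ->
  in_K1 A.
Proof.
move=> pA nv; have lA := pin_local pA; split.
- move=> I /(nonvaluation_two_generated pA nv)[a [b ->]].
  by exists a, b; rewrite span2 //; apply: local_subring lA.
- have [x [x0 Mx Mxx]] := pin_square pA nv.
  apply: (PVD_of_strong_max lA); exact: (conductor_strong pA nv x0 Mx Mxx).
- by case.
Qed.

(** The section of the value group sends [(n, m)] to [t ^ n * p ^ m], with [t]
    a uniformizer of the overring [A [p^-1]]: the first exponent dominates
    because every multiple of [t] by a power of [p] is still in [Q]. *)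
Lemma rank_two_K3 A M Q : pinched A M Q -> rank_two A M -> in_K3 A.
Proof.
move=> pA [vA [p [p0 eM nz]]]; split=> //; have lA := pin_local pA.
have rA := local_subring lA.
have [s s0 hs] := nonzero_elt (infinitely_divisible_ideal p rA).1 nz.
have [t t0 eQ] := rank_two_uniformizer pA p0 eM s0 hs.
have lW := rank_two_local pA vA p0 eM.
have uW := rank_two_separated pA p0 eM t0 eQ.
have Mp : M p by rewrite eM; apply: scale_id.
have Ap := local_sub lA Mp.
have Wp (m : int) : invert A p (p ^ m).
  case: m => n; first by apply: invert_sub; rewrite -exprnP; apply: subringX.
  rewrite NegzE -invr_expz -exprnP; exists n.+1.
  by rewrite mulVf ?expf_neq0 //; apply: subring1.
have tp0 (n m : int) : t ^ n * p ^ m != 0 by rewrite mulf_neq0 ?expfz_neq0.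
have tpV (n m : int) : (t ^ n * p ^ m)^-1 = t ^ (- n) * p ^ (- m).
  by rewrite invfM !invr_expz.
have Qpos (n m : int) : 0 < n -> Q (t ^ n * p ^ m).
  case: n => // -[//|n] _; rewrite -exprnP exprSr -mulrA mulrC.
  have Qt : Q t by rewrite eQ; apply: scale_id (local_subring lW) t0.
  have rW := local_subring lW; have [sQ QW] := local_idealP lW.
  rewrite mulrC mulrA mulrAC; apply: (submoduleZ sQ) => //.
  apply: subringM => //; apply: subringX => //; exact: QW.
have Mpos (m : int) : 0 < m -> M (p ^ m).
  case: m => // -[//|m] _; rewrite -exprnP exprSr.
  by apply: (submoduleZ (local_submod lA)) => //; apply: subringX.
have posA (n m : int) : A (t ^ n * p ^ m) <-> (0 < n) || ((0 == n) && (0 <= m)).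
  split; last first.
    case/orP => [/Qpos h|/andP[/eqP <- m0]]; first exact: (pin_ideal pA).2.
    rewrite expr0z mul1r; case: m m0 => // m _; rewrite -exprnP.
    exact: subringX.
  rewrite -[X in A X]invrK tpV => h.
  have nM : ~ M (t ^ (- n) * p ^ (- m)).
    by move/(local_nonunit lA); apply=> //; exact: tp0.
  case: (ltgtP 0 n) => //= hn.
  - by case: nM; apply: (pin_sub pA); apply: Qpos; rewrite oppr_gt0.
  - rewrite leNgt; apply/negP => m0; apply: nM.
    by rewrite -hn oppr0 expr0z mul1r; apply: Mpos; rewrite oppr_gt0.
apply: (value_group_of_section (e := fun g : int * int => t ^ g.1 * p ^ g.2)) => //.
- by move=> [g1 g2] [h1 h2]; rewrite !le_lexi_intE /= => h; congr (_, _); lia.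
- by move=> g h /=; rewrite !expfzDr // mulrACA.
- move=> g h; rewrite tpV mulrACA -!expfzDr // posA subr_gt0 subr_ge0.
  by rewrite [0 == _]eq_sym subr_eq0 [h.1 == _]eq_sym le_lexi_intE; split; exact: id.
- move=> y y0; have [n [h1 h2]] := uniformizer_decomp lW uW y0.
  have w0 : y / t ^ n != 0 by rewrite mulf_neq0 ?invr_neq0 ?expfz_neq0.
  have [|m [g1 g2]] := rank_two_order pA p0 eM w0 h1; first by rewrite invf_div.
  exists (n, m) => /=; split; first by rewrite invfM mulrA.
  by move: g2; rewrite invf_div mulrA (mulrC (p ^ m)).
Qed.
End LocalTypes.

(** * The real value group of a nondiscrete pinched valuation domain *)

Section Hoelder.
Variables (R : realType) (K : fieldType) (A M : set K) (u : K).
Hypotheses (lA : local_domain A M) (vA : is_valuation_domain A).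
Hypothesis arch : forall m y, M m -> m != 0 ->
  (forall n, A (y / m ^+ n)) -> y = 0.
Hypotheses (u0 : u != 0) (Mu : M u).
Let rA := local_subring lA.
Let sM := local_submod lA.
Let MA := local_sub lA.
Implicit Types (x y z m : K) (k : int) (r : R).

Lemma unit_power_ge0 k : A (u ^ k) -> 0 <= k.
Proof.
case: k => // n; rewrite NegzE -invr_expz -exprnP => h.
case: (local_nonunit lA Mu u0); rewrite (_ : u^-1 = (u ^+ n.+1)^-1 * u ^+ n).
  by apply: subringM => //; apply: subringX => //; apply: MA.
by rewrite exprS invfM -mulrA mulVf ?mulr1 // expf_neq0.
Qed.

(** For [y] in [A] the largest power of [u] dividing [y] works; otherwise the
    bracket of [y^-1] is reversed. *)
Lemma archimedean_bracket y : y != 0 ->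
  exists k, A (y / u ^ k) /\ A (u ^ (k + 1) / y).
Proof.
have pos z : A z -> z != 0 ->
    exists n : nat, A (z / u ^+ n) /\ A (u ^+ n.+1 / z).
  move=> Az z0; have ex : exists n, `[< ~ A (z / u ^+ n) >].
    apply: contrapT => h; move/eqP: z0; apply; apply: (arch Mu u0) => n.
    by apply: contrapT => hn; apply: h; exists n; apply/asboolP.
  case: (ex_minnP ex) => -[|n] /asboolP hn hmin.
    by case: hn; rewrite expr0 divr1.
  exists n; split.
    by apply: contrapT => /asboolP /hmin; rewrite ltnn.
  have nz : z / u ^+ n.+1 != 0 by rewrite mulf_neq0 ?invr_neq0 ?expf_neq0.
  by have [/hn //|] := vA nz; rewrite invf_div.
move=> y0; have [Ay|Ay] := vA y0.
- have [n [h1 h2]] := pos _ Ay y0; exists n%:Z.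
  by rewrite (_ : n%:Z + 1 = n.+1%:Z) //; lia.
- have y'0 : y^-1 != 0 by rewrite invr_eq0.
  have [n [h1 h2]] := pos _ Ay y'0; exists (- (n.+1%:Z)).
  rewrite (_ : - n.+1%:Z + 1 = - n%:Z); last by lia.
  rewrite -!invr_expz !invrK -!exprnP; split.
  + by move: h2; rewrite invrK mulrC.
  + by rewrite mulrC.
Qed.

(** Hoelder's cut: [A (x ^+ n / u ^ k)] says that [k / n] is at most the value
    of [x] measured in units of the value of [u]. *)
Definition lower_slopes x : set R :=
  [set r | exists k (n : nat),
    [/\ (0 < n)%N, A (x ^+ n / u ^ k) & r = k%:~R / n%:R]].

Definition real_value x : R := sup (lower_slopes x).

Lemma lower_slopes_ub x k (n : nat) : x != 0 -> (0 < n)%N ->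
  A (u ^ k / x ^+ n) -> ubound (lower_slopes x) (k%:~R / n%:R).
Proof.
move=> x0 n0 h _ [k' [n' [n'0 h' ->]]].
have : A ((u ^ k / x ^+ n) ^+ n' * (x ^+ n' / u ^ k') ^+ n).
  by apply: subringM => //; apply: subringX.
rewrite (_ : _ * _ = u ^ (k * n'%:Z - k' * n%:Z)); last first.
  rewrite !expr_div_n -!exprM mulnC -mulrA mulKf ?expf_neq0 //.
  by rewrite expfzDr // -invr_expz !exprnP !exprz_exp.
move/unit_power_ge0; rewrite subr_ge0 => le_kk.
rewrite ler_pdivrMr ?ltr0n // mulrAC ler_pdivlMr ?ltr0n //.
by rewrite -[n%:R]/(n%:Z%:~R) -[n'%:R]/(n'%:Z%:~R) -!intrM ler_int.
Qed.

Lemma lower_slopes_nonempty x : x != 0 -> lower_slopes x !=set0.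
Proof.
move=> x0; have [k [h1 _]] := archimedean_bracket x0.
by exists (k%:~R / 1%:R), k, 1; rewrite expr1.
Qed.

Lemma real_value_ge x k (n : nat) : x != 0 -> (0 < n)%N -> A (x ^+ n / u ^ k) ->
  k%:~R / n%:R <= real_value x.
Proof.
move=> x0 n0 h; apply: ub_le_sup; last by exists k, n.
have [k' [_ h2]] := archimedean_bracket x0.
by exists ((k' + 1)%:~R / 1%:R); apply: lower_slopes_ub.
Qed.

Lemma real_value_le x k (n : nat) : x != 0 -> (0 < n)%N -> A (u ^ k / x ^+ n) ->
  real_value x <= k%:~R / n%:R.
Proof.
move=> x0 n0 h; apply: ge_sup; first exact: lower_slopes_nonempty.
exact: lower_slopes_ub.
Qed.

(** Bracketing [x ^ n] and [y ^ n] between consecutive powers of [u] bounds the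
    defect of additivity by [2 / n], for every [n]. *)
Lemma real_valueM x y : x != 0 -> y != 0 ->
  real_value (x * y) = real_value x + real_value y.
Proof.
move=> x0 y0; have xy0 : x * y != 0 by rewrite mulf_neq0.
set d := real_value (x * y) - (real_value x + real_value y).
have bound (n : nat) : (0 < n)%N -> `|d| * n%:R <= 2.
  move=> n0; have nR : 0 < n%:R :> R by rewrite ltr0n.
  have [k [k1 k2]] := archimedean_bracket (expf_neq0 n x0).
  have [l [l1 l2]] := archimedean_bracket (expf_neq0 n y0).
  have := real_value_ge x0 n0 k1; have := real_value_le x0 n0 k2.
  have := real_value_ge y0 n0 l1; have := real_value_le y0 n0 l2.
  have : A ((x * y) ^+ n / u ^ (k + l)).
    by rewrite exprMn expfzDr // invfM mulrACA; apply: subringM.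
  move/(real_value_ge xy0 n0).
  have : A (u ^ (k + 1 + (l + 1)) / (x * y) ^+ n).
    by rewrite exprMn expfzDr // invfM mulrACA; apply: subringM.
  move/(real_value_le xy0 n0).
  rewrite !ler_pdivrMr // !ler_pdivlMr // !intrD.
  move=> h1 h2 h3 h4 h5 h6.
  rewrite -[X in _ * X]gtr0_norm // -normrM ler_norml /d !mulrDl mulNr mulrDl.
  by apply/andP; split; lra.
apply/eqP; rewrite -subr_eq0 -/d -normr_eq0; apply/negPn/negP => d0.
have dp : 0 < `|d| by rewrite lt0r d0 normr_ge0.
have [n hn] : exists n : nat, 2 / `|d| < n%:R.
  by exists (Num.bound (2 / `|d|)); apply: archi_boundP; rewrite divr_ge0.
have := bound n.+1 isT; rewrite leNgt mulrC -ltr_pdivrMr //.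
by rewrite (lt_le_trans hn) // ler_nat.
Qed.

Lemma real_value1 : real_value 1 = 0.
Proof.
have := real_valueM (oner_neq0 K) (oner_neq0 K); rewrite mulr1 => h.
by apply: (addrI (real_value 1)); rewrite addr0 -h.
Qed.

Lemma real_valueV x : x != 0 -> real_value x^-1 = - real_value x.
Proof.
move=> x0; apply/eqP; rewrite -addr_eq0 -real_valueM ?invr_eq0 //.
by rewrite mulVf // real_value1.
Qed.

Lemma real_value_pos m : M m -> m != 0 -> 0 < real_value m.
Proof.
move=> Mm m0; have [n nA] : exists n, ~ A (u / m ^+ n).
  apply: contrapT => h; move/eqP: u0; apply; apply: (arch Mm m0) => n.
  by apply: contrapT => hn; apply: h; exists n.
case: n nA => [|n]; first by rewrite expr0 divr1 => /(_ (MA Mu)).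
move=> nA; have nz : u / m ^+ n.+1 != 0.
  by rewrite mulf_neq0 ?invr_neq0 ?expf_neq0.
have [/nA //|] := vA nz; rewrite invf_div => h.
have {}h : A (m ^+ n.+1 / u ^ 1) by rewrite expr1z.
by apply: (lt_le_trans _ (@real_value_ge m 1 n.+1 m0 isT h)); rewrite divr_gt0 ?ltr0n.
Qed.

Lemma real_value_ge0 x : x != 0 -> 0 <= real_value x <-> A x.
Proof.
move=> x0; split=> [|Ax].
- apply: contraPP => nAx; apply/negP; rewrite -ltNge.
  rewrite -oppr_gt0 -real_valueV //.
  by apply: real_value_pos; rewrite ?invr_eq0 //; exact: local_valuation_max nAx.
- have := @real_value_ge x 0 1 x0 isT.
  by rewrite mul0r expr1 expr0z divr1; apply.
Qed.

Lemma real_value_div x y : x != 0 -> y != 0 ->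
  real_value x <= real_value y <-> A (y / x).
Proof.
move=> x0 y0; rewrite -(real_value_ge0 _) ?mulf_neq0 ?invr_eq0 //.
by rewrite real_valueM ?invr_eq0 // real_valueV // subr_ge0.
Qed.

Section Surjective.
Hypothesis npM : ~ principal A M.
Hypothesis ideals : forall I, is_ideal A I -> I <> [set 0] ->
  principal A I \/ exists x, [/\ A x, x != 0 & I = scale x M].

(** No generator of [M] exists, so every value of [M] splits as a sum of two,
    one of which is at most half of it. *)
Lemma real_value_halve m : M m -> m != 0 ->
  exists m', [/\ M m', m' != 0 & real_value m' <= real_value m / 2].
Proof.
move=> Mm m0; have [m' [Mm' nA]] : exists m', M m' /\ ~ A (m' / m).
  apply: contrapT => h; apply: npM; exists m => //.
  apply/seteqP; split=> z; rewrite /scale /= => hz.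
  - by apply: contrapT => nA; apply: h; exists z.
  - by rewrite -(divfK m0 z); apply: (submoduleZ sM).
have m'0 : m' != 0.
  by apply: contra_notN nA => /eqP ->; rewrite mul0r; apply: subring0.
have Mq : M (m / m') by rewrite -invf_div; exact: local_valuation_max nA.
have q0 : m / m' != 0 by rewrite mulf_neq0 ?invr_eq0.
have e : real_value m = real_value m' + real_value (m / m').
  by rewrite -real_valueM // mulrC divfK.
have [h|h] := leP (real_value m') (real_value (m / m')).
- by exists m'; split=> //; lra.
- by exists (m / m'); split=> //; lra.
Qed.

Lemma real_value_small (eps : R) : 0 < eps ->
  exists m, [/\ M m, m != 0 & real_value m < eps].
Proof.
move=> eps0; have small (n : nat) :
    exists m, [/\ M m, m != 0 & real_value m * n.+1%:R <= real_value u].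
  elim: n => [|n [m [Mm m0 h]]]; first by exists u; rewrite mulr1.
  have [m' [Mm' m'0 h']] := real_value_halve Mm m0.
  exists m'; split=> //; have m'p := real_value_pos Mm' m'0.
  have n0 : 0 <= n%:R :> R by [].
  by move: h; rewrite -!natr1; nra.
have [n hn] : exists n : nat, real_value u / eps < n%:R.
  exists (Num.bound (real_value u / eps)); apply: archi_boundP.
  by rewrite divr_ge0 // ltW // real_value_pos.
have [m [Mm m0 h]] := small n; exists m; split=> //.
move: hn; rewrite ltr_pdivrMr // => hn; move: h; rewrite -natr1 => h.
have n0 : 0 <= n%:R :> R by [].
rewrite ltNge; apply/negP => le_em; have := real_value_pos Mm m0; nra.
Qed.

(** The elements of value above [r] form an ideal, so it lies between [z M] and
    [z A] for some [z]. Since [M] has elements of arbitrarily small value, the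
    value of [z] can be neither below nor above [r]. *)
Lemma real_value_surj_ge0 r : 0 <= r -> exists2 x, x != 0 & real_value x = r.
Proof.
move=> r0; pose I := [set x | x != 0 -> r < real_value x].
have iI : is_ideal A I.
  split; last first.
    move=> x Ix; have [->|x0] := eqVneq x 0; first exact: subring0.
    by apply/(real_value_ge0 x0); rewrite ltW // (le_lt_trans r0) // Ix.
  have IZ a x : A a -> I x -> I (a * x).
    move=> Aa Ix; rewrite /I /= mulf_eq0 negb_or => /andP[a0 x0].
    rewrite real_valueM // ltr_wpDl ?Ix //; exact/real_value_ge0.
  split=> //; first by rewrite /I /= eqxx.
  move=> x y Ix Iy; have [->|x0] := eqVneq x 0; first by rewrite add0r.
  have [->|y0] := eqVneq y 0; first by rewrite addr0.
  have [le_xy|/ltW le_yx] := leP (real_value x) (real_value y).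
  - rewrite -(divfK x0 (x + y)); apply: IZ => //; rewrite mulrDl divff //.
    by apply: subringD => //; [exact: subring1|exact/real_value_div].
  - rewrite -(divfK y0 (x + y)); apply: IZ => //; rewrite mulrDl divff //.
    by apply: subringD => //; [exact/real_value_div|exact: subring1].
have I0 : I <> [set 0].
  have [n hn] : exists n : nat, r < n%:R.
    by exists (Num.bound r); apply: archi_boundP.
  have un0 := expf_neq0 n u0.
  apply: (nonzero_set un0) => _; apply: (lt_le_trans hn).
  have := @real_value_ge (u ^+ n) n 1 un0 isT; rewrite expr1 divr1.
  by rewrite -exprnP divff //; apply; apply: subring1.
have [z [z0 zMI IzA]] : exists z,
    [/\ z != 0, scale z M `<=` I & I `<=` scale z A].
  have [[z z0 eI]|[z [_ z0 eI]]] := ideals iI I0; exists z; split=> //.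
  - by rewrite eI => y; rewrite /scale /= => /MA.
  - by rewrite eI.
  - by rewrite eI.
  - by rewrite eI => y; rewrite /scale /= => /MA.
exists z => //; have [lt_zr|lt_rz|//] := ltgtP (real_value z) r.
- have := lt_zr; rewrite -subr_gt0 => /real_value_small[m [Mm m0 hm]].
  have : I (z * m) by apply: zMI; apply: scale_mem.
  by rewrite /I /= mulf_neq0 // real_valueM // => /(_ isT); lra.
- have := lt_rz; rewrite -subr_gt0 => /real_value_small[m [Mm m0 hm]].
  have : I (z / m).
    move=> _; rewrite real_valueM ?invr_eq0 // real_valueV //; lra.
  move/IzA; rewrite /scale /= mulrAC divff // mul1r => h.
  by case: (local_nonunit lA Mm m0).
Qed.

Lemma real_value_surj r : exists2 x, x != 0 & real_value x = r.
Proof.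
have [/real_value_surj_ge0//|r0] := leP 0 r.
have [|x x0 e] := @real_value_surj_ge0 (- r); first by rewrite oppr_ge0 ltW.
by exists x^-1; rewrite ?invr_eq0 // real_valueV // e opprK.
Qed.

End Surjective.
End Hoelder.

Lemma nondiscrete_K2 (R : realType) (K : fieldType) (A M Q : set K) :
  pinched A M Q -> M <> [set 0] -> nondiscrete A M -> in_K2 R A.
Proof.
move=> pA M0 [vA npM]; have lA := pin_local pA.
have eMQ : M = Q by have [//|/npM] := pin_max_cases pA.
have [u u0 Mu] := nonzero_elt (local_submod lA) M0.
have arch m y : M m -> m != 0 -> (forall n, A (y / m ^+ n)) -> y = 0.
  by rewrite eMQ => Qm m0; apply: (pin_separated pA Qm m0).
have ideals I : is_ideal A I -> I <> [set 0] ->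
    principal A I \/ exists x, [/\ A x, x != 0 & I = scale x M].
  by rewrite eMQ; exact: pin_all pA I.
split=> //; exists (real_value R A u); split.
- by move=> x y; apply: (real_valueM _ lA vA arch u0 Mu).
- exact: (real_value_surj lA vA arch u0 Mu npM ideals).
- by move=> x y; apply: (real_value_div _ lA vA arch u0 Mu).
Qed.

(** * Maximal ideals, localizations and quasi-local overrings *)

Section Globalization.
Variable K : fieldType.
Implicit Types (A B C D I J M N P X L : set K) (x y z a b d s : K).

Lemma max_not1 A M : is_subring A -> Max A M -> ~ M 1.
Proof. by move=> rA [iM nM _] M1; apply: nM; apply: ideal_unit. Qed.

Lemma max_prime A M x y : is_subring A -> Max A M -> A x -> A y ->
  M (x * y) -> M x \/ M y.
Proof.
move=> rA hM Ax Ay Mxy; have [iM nM mM] := hM; have [sM MA] := iM.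
have [Mx|nMx] := pselect (M x); [by left|right].
pose J := [set z | exists m a, [/\ M m, A a & z = m + a * x]].
have iJ : is_ideal A J.
  split; last first.
    move=> _ [m [a [Mm Aa ->]]]; apply: subringD => //; first exact: MA.
    exact: subringM.
  split.
  - exists 0, 0; rewrite mul0r addr0; split=> //; first exact: submodule0 sM.
    exact: subring0.
  - move=> _ _ [m [a [Mm Aa ->]]] [m' [a' [Mm' Aa' ->]]].
    exists (m + m'), (a + a'); split; [exact: submoduleD sM Mm Mm'|
      exact: subringD|ring].
  - move=> c _ Ac [m [a [Mm Aa ->]]].
    by exists (c * m), (c * a); split; [exact: submoduleZ sM Ac Mm|
      exact: subringM|ring].
have MJ : M `<=` J.
  by move=> m Mm; exists m, 0; split=> //; [exact: subring0|rewrite mul0r addr0].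
have [eJ|eJ] := mM _ iJ MJ.
  case: nMx; rewrite -eJ; exists 0, 1; rewrite mul1r add0r; split=> //.
    exact: submodule0 sM.
  exact: subring1.
have [m [a [Mm Aa e]]] : J 1 by rewrite eJ; apply: subring1.
rewrite -(mulr1 y) e mulrDr; apply: (submoduleD sM).
  exact: (submoduleZ sM).
by rewrite mulrCA (mulrC y); apply: (submoduleZ sM).
Qed.

Lemma max_mul A M x y : is_subring A -> Max A M -> A x -> A y ->
  ~ M x -> ~ M y -> ~ M (x * y).
Proof. by move=> rA hM Ax Ay nx ny /(max_prime rA hM Ax Ay)[]. Qed.

(** Zorn's lemma, applied to the sets whose union with [I] is a proper ideal:
    in this form the empty chain needs no separate treatment. *)
Lemma max_exists A I : is_subring A -> is_ideal A I -> I <> A ->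
  exists2 M, Max A M & I `<=` M.
Proof.
move=> rA iI nI.
pose P : set (set K) := [set X | is_ideal A (X `|` I) /\ ~ (X `|` I) 1].
have nI1 : ~ I 1 by move=> I1; apply: nI; apply: ideal_unit.
have chain (F : set (set K)) : F `<=` P -> total_on F subset ->
    P (\bigcup_(X in F) X).
  move=> FP tF; have sX X : F X -> is_submodule A (X `|` I).
    by move=> /FP[[]].
  split; last by move=> [[X FX X1]|//]; case: (FP _ FX) => _; apply; left.
  split; last first.
    move=> x [[X FX Xx]|Ix]; last exact: iI.2.
    by have [[_ XA] _] := FP _ FX; apply: XA; left.
  have up X x : F X -> (X `|` I) x -> ((\bigcup_(X in F) X) `|` I) x.
    by move=> FX [Xx|Ix]; [left; exists X|right].
  split.
  - by right; apply: submodule0 iI.1.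
  - move=> x y [[X FX Xx]|Ix] [[Y FY Yy]|Iy].
    + have [XY|YX] := tF _ _ FX FY.
      * by apply: (up Y) => //; apply: (submoduleD (sX Y FY)); left => //; exact: XY.
      * by apply: (up X) => //; apply: (submoduleD (sX X FX)); left => //; exact: YX.
    + by apply: (up X) => //; apply: (submoduleD (sX X FX)); [left|right].
    + by apply: (up Y) => //; apply: (submoduleD (sX Y FY)); [right|left].
    + by right; apply: (submoduleD iI.1).
  - move=> a x Aa [[X FX Xx]|Ix].
    + by apply: (up X) => //; apply: (submoduleZ (sX X FX)) => //; left.
    + by right; apply: (submoduleZ iI.1).
have [X [[iX nX] mX]] := Zorn_bigcup chain.
exists (X `|` I); last by move=> x; right.
split=> //; first by move=> e; apply: nX; rewrite e; apply: subring1.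
move=> J iJ XJ; have [->|nJ] := pselect (J = A); [by right|left].
have eJ : J `|` I = J.
  by apply/seteqP; split=> x; [case=> // Ix; apply: XJ; right|left].
apply/seteqP; split=> // x Jx; left; apply: contrapT => nXx.
apply: (mX J); last first.
  by rewrite /P /= eJ; split=> // -[J1|//]; apply: nJ; apply: ideal_unit.
by split; [move=> y Xy; apply: XJ; left|move=> /(_ _ Jx)].
Qed.

(** The elements [d] of [A] with [d z] in [N] form an ideal that no maximal
    ideal contains. *)
Lemma local_global A N z : is_subring A -> is_submodule A N ->
  (forall M, Max A M -> exists d, [/\ A d, ~ M d & N (d * z)]) -> N z.
Proof.
move=> rA sN h; pose J := [set d | A d /\ N (d * z)].
have iJ : is_ideal A J.
  split; last by move=> d [].
  split.
  - by split; [exact: subring0|rewrite mul0r; exact: submodule0 sN].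
  - move=> x y [Ax Nx] [Ay Ny]; split; first exact: subringD.
    by rewrite mulrDl; apply: (submoduleD sN).
  - move=> a x Aa [Ax Nx]; split; first exact: subringM.
    by rewrite -mulrA; apply: (submoduleZ sN).
have [eJ|/(max_exists rA iJ)[M hM JM]] := pselect (J = A).
  have [_] : J 1 by rewrite eJ; apply: subring1.
  by rewrite mul1r.
by have [d [Ad nMd Nd]] := h _ hM; case: nMd; apply: JM.
Qed.

Lemma quasi_local_local A : is_domain_of A -> quasi_local A ->
  exists M, local_domain A M.
Proof.
move=> dA [M eM]; have rA := dA.1.
have hM : Max A M by rewrite eM.
have [iM nM _] := hM; exists M; split=> //; first exact: max_not1 hM.
move=> x Ax nMx; have x0 : x != 0.
  by apply: contra_notN nMx => /eqP ->; exact: submodule0 iM.1.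
have iI := ideal_scale rA (is_ideal_self rA) Ax x0.
have [e|/(max_exists rA iI)[N hN xN]] := pselect (scale x A = A).
  have : scale x A 1 by rewrite e; apply: subring1.
  by rewrite /scale /= div1r.
case: nMx; move: hN; rewrite eM => /= <-; apply: xN; exact: scale_id.
Qed.

(** [I D_M]; for [I = D] this is the localization itself. *)
Definition extension D M I : set K :=
  [set x | exists a s, [/\ I a, D s, ~ M s & x = a / s]].

Section Localization.
Variables (D M : set K).
Hypotheses (dD : is_domain_of D) (hM : Max D M).
Let rD := dD.1.
Let L := localization D M.

Let sM : is_submodule D M. Proof. by have [[]] := hM. Qed.
Let MD : M `<=` D. Proof. by have [[]] := hM. Qed.

Lemma notin_max_neq0 s : ~ M s -> s != 0.
Proof. by apply: contra_notN => /eqP ->; exact: submodule0 sM. Qed.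

Lemma extension_self I : I `<=` extension D M I.
Proof.
move=> x Ix; exists x, 1; rewrite divr1; split=> //; first exact: subring1.
exact: max_not1 hM.
Qed.

Lemma localization_sub : D `<=` L.
Proof. exact: extension_self. Qed.

Lemma extension_submodule I : is_submodule D I ->
  is_submodule L (extension D M I).
Proof.
move=> sI; split.
- by apply: extension_self; apply: submodule0 sI.
- move=> _ _ [a [s [Ia Ds nMs ->]]] [b [t [Ib Dt nMt ->]]].
  exists (t * a + s * b), (s * t); split; [|exact: subringM|exact: (max_mul rD hM)|].
    by apply: (submoduleD sI); apply: (submoduleZ sI).
  by field; rewrite !notin_max_neq0.
- move=> _ _ [a [s [Da Ds nMs ->]]] [b [t [Ib Dt nMt ->]]].
  exists (a * b), (s * t); split; [|exact: subringM|exact: (max_mul rD hM)|].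
    exact: (submoduleZ sI).
  by field; rewrite !notin_max_neq0.
Qed.

Lemma localization_subring : is_subring L.
Proof.
have [L0 LD LM] := extension_submodule (is_submodule_self rD).
have L1 : L 1 by apply: localization_sub; apply: subring1.
apply: is_subringP => // x y Lx Ly; apply: (LD) => //.
rewrite -mulN1r; apply: (LM) => //.
by apply: localization_sub; apply: subringN => //; apply: subring1.
Qed.

Lemma localization_domain : is_domain_of L.
Proof.
split; first exact: localization_subring.
move=> x; have [a [b [Aa Ab b0 e]]] := dD.2 x.
by exists a, b; split=> //; apply: localization_sub.
Qed.

Lemma extension_max x : D x -> extension D M M x -> M x.
Proof.
move=> Dx [a [s [Ma Ds nMs e]]].
have : M (x * s) by rewrite e divfK // notin_max_neq0.
by move=> /(max_prime rD hM Dx Ds)[].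
Qed.

Lemma localization_local : local_domain L (extension D M M).
Proof.
split; first exact: localization_domain.
- split; first exact: extension_submodule.
  by move=> x [a [s [Ma Ds nMs ->]]]; exists a, s; split=> //; apply: MD.
- by move/(extension_max (subring1 rD)); apply: max_not1 hM.
- move=> _ [a [s [Da Ds nMs ->]]] nM; rewrite invf_div; exists s, a; split=> //.
  by move=> Ma; apply: nM; exists a, s.
Qed.

Lemma localization_inv s : D s -> ~ M s -> L s^-1.
Proof.
by move=> Ds nMs; exists 1, s; rewrite div1r; split=> //; apply: subring1.
Qed.

Lemma localization_ideal N x : is_submodule L N -> N `<=` L -> N x ->
  exists s, [/\ D s, ~ M s & (N `&` D) (s * x)].
Proof.
move=> sN NL Nx; have [a [s [Da Ds nMs e]]] := NL _ Nx.
exists s; split=> //; split.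
  by apply: (submoduleZ sN) => //; apply: localization_sub.
by rewrite e mulrC divfK // notin_max_neq0.
Qed.

Lemma max_neq0 : ~ is_field D -> M <> [set 0].
Proof.
move=> nF eM; apply: nF => x Dx x0.
have [_ _ mM] := hM; have iI := ideal_scale rD (is_ideal_self rD) Dx x0.
have [|e|e] := mM _ iI.
- by rewrite eM => _ ->; rewrite /scale /= mul0r; apply: subring0.
- have : scale x D x by apply: scale_id.
  by rewrite e eM => /= xe; move: x0; rewrite xe eqxx.
- have : scale x D 1 by rewrite e; apply: subring1.
  by rewrite /scale /= div1r.
Qed.

Lemma extension_max_neq0 : ~ is_field D -> extension D M M <> [set 0].
Proof.
move/max_neq0 => /(nonzero_elt sM)[m m0 Mm].
by apply: (nonzero_set m0); apply: extension_self.
Qed.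

Lemma localization_neqT : ~ is_field D -> L <> setT.
Proof.
move=> nF e; have [m m0 Mm] := nonzero_elt sM (max_neq0 nF).
have Mm' : extension D M M m by apply: extension_self.
by apply: (local_nonunit localization_local Mm' m0); rewrite -/L e.
Qed.

End Localization.

Section Overrings.
Variable D : set K.
Hypotheses (dD : is_domain_of D).
Let rD := dD.1.

Lemma overring_domain B : is_overring D B -> is_domain_of B.
Proof.
case=> rB DB; split=> // x; have [a [b [Da Db b0 e]]] := dD.2 x.
by exists a, b; split=> //; apply: DB.
Qed.

Lemma center_prime B N : is_overring D B -> local_domain B N ->
  is_prime_ideal D (N `&` D).
Proof.
move=> [rB DB] lB; have sN := local_submod lB.
split; [split; [split|]| |].
- by split; [exact: submodule0 sN|exact: subring0].
- move=> x y [Nx Dx] [Ny Dy]; split; [exact: submoduleD sN Nx Ny|exact: subringD].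
- move=> a x Da [Nx Dx]; split; [apply: (submoduleZ sN) => //; exact: DB|].
  exact: subringM.
- by move=> x [].
- move=> e; have [] : (N `&` D) 1 by rewrite e; apply: subring1.
  by move/(local_proper lB).
- move=> x y Dx Dy [Nxy _].
  have [Nx|nNx] := pselect (N x); [by left|right; split=> //].
  have x0 : x != 0.
    by apply: contra_notN nNx => /eqP ->; exact: submodule0 sN.
  rewrite -(mulKf x0 y); apply: (submoduleZ sN) => //.
  by apply: (local_unit lB) => //; apply: DB.
Qed.

(** If the maximal ideal of [B] met [D] in zero, all nonzero elements of [D]
    would be units of [B]. *)
Lemma center_neq0 B N : is_overring D B -> local_domain B N -> B <> setT ->
  N `&` D <> [set 0].
Proof.
move=> [rB DB] lB nB e; apply: nB; apply/seteqP; split=> // x _.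
have [a [b [Da Db b0 ->]]] := dD.2 x; apply: subringM => //; first exact: DB.
apply: (local_unit lB); first exact: DB.
move=> Nb; have : (N `&` D) b by [].
by rewrite e => /= be; move: b0; rewrite be eqxx.
Qed.

Lemma localization_sub_overring B N M : is_overring D B -> local_domain B N ->
  Max D M -> (localization D M `<=` B <-> N `&` D `<=` M).
Proof.
move=> [rB DB] lB hM; split=> h x.
- move=> [Nx Dx]; apply: contrapT => nMx.
  have x0 := notin_max_neq0 hM nMx.
  apply: (local_nonunit lB Nx x0); apply: h.
  exact: localization_inv.
- move=> [a [s [Da Ds nMs ->]]]; apply: subringM => //; first exact: DB.
  apply: (local_unit lB); first exact: DB.
  by move=> Ns; apply: nMs; apply: h.
Qed.

(** The maximal ideals [M] with [D_M] inside [B] are those containing the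
    center of [B] on [D], a nonzero prime. *)
Lemma quasi_local_overring_max B : is_h_local D -> O_ql D B -> B <> setT ->
  exists! M, Max D M /\ localization D M `<=` B.
Proof.
move=> [_ hl] [oB qB] nB; have [N lB] := quasi_local_local (overring_domain oB) qB.
have [M [[hM PM] uM]] := hl _ (center_prime oB lB) (center_neq0 oB lB nB).
exists M; split.
  by split=> //; apply/(localization_sub_overring oB lB hM).
move=> M' [hM' LM']; apply: uM; split=> //.
by apply/(localization_sub_overring oB lB hM').
Qed.

Lemma O_ql_setT : O_ql D setT.
Proof.
have rT : is_subring (setT : set K) by apply: is_subringP.
split; first by split.
apply: (@local_quasi_local _ _ [set 0]); split=> //.
- by split=> // x; exists x, 1; rewrite divr1; split=> //; exact: oner_neq0.
- by split=> //; split=> //= [x y -> ->|a x _ ->]; rewrite ?addr0 ?mulr0.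
- by move=> /= /eqP; rewrite oner_eq0.
Qed.

End Overrings.
End Globalization.

(** * Local domains with at most one intermediate ring *)

Section LocalOverrings.
Variable K : fieldType.
Implicit Types (A B C E I M N Q X : set K) (x y z a b p m : K).

Definition middle_overring A E : Prop :=
  [/\ is_overring A E, quasi_local E, E <> A, E <> setT
    & forall C, is_overring A C -> [\/ C = A, C = E | C = setT]].

Definition maximal_subring A : Prop :=
  forall C, is_overring A C -> C = A \/ C = setT.

Lemma overring_elt A C : is_overring A C -> C <> A -> exists2 z, C z & ~ A z.
Proof.
move=> [_ AC] nCA; apply: contrapT => h; apply: nCA; apply/seteqP; split=> // z Cz.
by apply: contrapT => nAz; apply: h; exists z.
Qed.

(** Here [Q = M], so [pin_separated] applies to the inverse of any element of
    [C] outside [A]. *)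
Lemma nondiscrete_overrings A M Q : pinched A M Q -> nondiscrete A M ->
  maximal_subring A.
Proof.
move=> pA [vA npM] C oC; have [eC|nC] := pselect (C = A); [by left|right].
have [z Cz nAz] := overring_elt oC nC; have [rC AC] := oC.
have lA := pin_local pA.
have eMQ : M = Q by have [//|/npM] := pin_max_cases pA.
have z0 : z != 0.
  by apply: contra_notN nAz => /eqP ->; apply: subring0 (local_subring lA).
have z'0 : z^-1 != 0 by rewrite invr_eq0.
apply: (overring_full rC AC vA z'0); first by rewrite invrK.
apply: (pin_separated pA _ z'0); rewrite -eMQ.
exact: local_valuation_max nAz.
Qed.

Lemma discrete_overrings A M : local_domain A M -> discrete A M ->
  maximal_subring A.
Proof.
move=> lA [p uA] C oC; have [eC|nC] := pselect (C = A); [by left|right].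
have vA := uniformizer_valuation lA uA; have [p0 eM sep] := uA.
have [z Cz nAz] := overring_elt oC nC; have [rC AC] := oC.
have z0 : z != 0.
  by apply: contra_notN nAz => /eqP ->; apply: subring0 (local_subring lA).
apply: (overring_full rC AC vA p0) => //.
have := local_valuation_max lA vA nAz; rewrite eM /scale /= => h.
by rewrite -(mulVKf z0 p^-1); apply: subringM => //; exact: AC.
Qed.

Lemma nonvaluation_middle A M Q : pinched A M Q -> ~ is_valuation_domain A ->
  exists E, middle_overring A E.
Proof.
move=> pA nv; have [x [x0 Mx Mxx]] := pin_square pA nv.
exists (conductor_ring M x); split.
- by split; [exact: (conductor_subring pA x0 Mx Mxx)|exact: (conductor_sub pA Mx)].
- exact: (local_quasi_local (conductor_local pA nv x0 Mx Mxx)).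
- exact: (conductor_neq pA nv x0).
- exact: (conductor_neqT pA x0).
- by move=> C [rC AC]; exact: (conductor_overrings pA nv x0 Mx Mxx).
Qed.

Lemma rank_two_middle A M Q : pinched A M Q -> rank_two A M ->
  exists E, middle_overring A E.
Proof.
move=> pA [vA [p [p0 eM nz]]]; have lA := pin_local pA.
have rA := local_subring lA.
have [s s0 hs] := nonzero_elt (infinitely_divisible_ideal p rA).1 nz.
exists (invert A p); split.
- by split; [exact: (invert_subring pA p0 eM)|exact: invert_sub].
- exact: local_quasi_local (rank_two_local pA vA p0 eM).
- exact: (invert_neq pA p0 eM).
- exact: (invert_neqT pA p0 eM s0 hs).
- by move=> C [rC AC]; exact: (rank_two_overrings pA vA p0 eM s0 hs).
Qed.

Lemma discrete_two_generated A M Q I : pinched A M Q -> discrete A M ->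
  is_ideal A I -> exists a b, I = gen2 A a b.
Proof.
move=> pA [p [p0 eM sep]] iI; have rA := local_subring (pin_local pA).
have [->|I0] := pselect (I = [set 0]); first by exists 0, 0; rewrite gen2_zero.
have [[x x0 ->]|[x [_ x0 eI]]] := pin_all pA iI I0.
  by exists x, x; rewrite gen2_scale.
case: I0; rewrite eI; apply/seteqP; split=> z; rewrite /scale /=; last first.
  by move=> ->; rewrite mul0r; apply: submodule0 (pin_ideal pA).1.
move=> Qz; have : z / x = 0.
  apply: sep => n; apply: (pin_ideal pA).2; elim: n => [|n IHn].
    by rewrite expr0 divr1.
  by rewrite exprSr invfM mulrA; apply: (pin_generator_div pA p0 eM).
by move/eqP; rewrite mulf_eq0 invr_eq0 (negPf x0) orbF => /eqP.
Qed.

End LocalOverrings.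

(** * Noetherian, Pruefer and Dedekind domains from their localizations *)

Section GlobalProperties.
Variables (K : fieldType) (D : set K).
Hypothesis dD : is_domain_of D.
Let rD := dD.1.
Implicit Types (I J M N X : set K) (x y z a b d s : K).

Lemma sub_ring_submodule A B N : A `<=` B -> is_submodule B N ->
  is_submodule A N.
Proof. by move=> AB [N0 ND NZ]; split=> // a x /AB; exact: NZ. Qed.

Lemma span_localization I X M : Max D M -> is_ideal (localization D M) I ->
  I `&` D = span D X -> I = span (localization D M) X.
Proof.
move=> hM [sI IL] e; have sL := span_submodule (localization D M) X.
apply/seteqP; split; last first.
  by apply: span_min => // x Xx; have [] : (I `&` D) x by rewrite e; apply: sub_span.
move=> z Iz; have [s [Ds nMs]] := localization_ideal dD hM sI IL Iz.
rewrite e => hsz; rewrite -(mulKf (notin_max_neq0 hM nMs) z).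
apply: (submoduleZ sL); first exact: localization_inv.
move: hsz; apply: span_min; last exact: sub_span.
by apply: sub_ring_submodule sL; apply: localization_sub.
Qed.

Lemma Noetherian_valuation_discrete M : is_Noetherian D -> ~ is_field D ->
  Max D M -> is_valuation_domain (localization D M) ->
  discrete (localization D M) (extension D M M).
Proof.
move=> nD nF hM vL; have lL := localization_local dD hM.
apply: (PID_discrete lL); first exact: extension_max_neq0.
move=> I iI I0; have iID : is_ideal D (I `&` D).
  split; last by move=> x [].
  have DL := localization_sub dD hM; have [sI _] := iI.
  split.
  - by split; [exact: submodule0 sI|exact: subring0].
  - move=> x y [Ix Dx] [Iy Dy]; split; [exact: submoduleD sI Ix Iy|exact: subringD].
  - move=> a x Da [Ix Dx]; split; [apply: (submoduleZ sI) => //; exact: DL|].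
    exact: subringM.
have [X fX eX] := nD _ iID; have eI := span_localization hM iI eX.
by rewrite eI; apply: span_principal => //; [exact: local_subring lL|rewrite -eI].
Qed.

(** Two local generators of an ideal at each of the finitely many maximal
    ideals, with denominators cleared, together generate it locally everywhere,
    hence globally. *)
Lemma Noetherian_of_local : finite_set (Max D) ->
  (forall M I, Max D M -> is_ideal (localization D M) I ->
     exists a b, I = gen2 (localization D M) a b) ->
  is_Noetherian D.
Proof.
move=> fM h I iI; have sI := iI.1.
have local_gen M : exists ab : K * K, Max D M -> [/\ I ab.1, I ab.2 &
    forall z, I z -> exists d, [/\ D d, ~ M d & gen2 D ab.1 ab.2 (d * z)]].
  have [hM|nM] := pselect (Max D M); last by exists (0, 0).
  have iE : is_ideal (localization D M) (extension D M I).
    split; first exact: extension_submodule.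
    by move=> _ [a [s [Ia Ds nMs ->]]]; exists a, s; split=> //; apply: iI.2.
  have [a [b e]] := h _ _ hM iE; have rL := localization_subring dD hM.
  have [a' [s [Ia' Ds nMs ea]]] : extension D M I a by rewrite e; apply: gen2_l.
  have [b' [t [Ib' Dt nMt eb]]] : extension D M I b by rewrite e; apply: gen2_r.
  exists (a', b') => _; split=> // z Iz.
  have : extension D M I z by exact: extension_self.
  rewrite e ea eb => -[_ [_ [[c [q [Dc Dq nMq ->]]] [d [r [Dd Dr nMr ->]]] ez]]].
  exists (q * s * (r * t)).
  split; [by do ?apply: subringM|by do ?[apply: (max_mul rD hM)|apply: subringM]|].
  exists (c * (r * t)), (d * (q * s)); split; [by do ?apply: subringM..|].
  by rewrite ez /=; field; rewrite !(notin_max_neq0 hM).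
have [f hf] := choice local_gen.
pose X := (fst \o f) @` Max D `|` (snd \o f) @` Max D.
exists X; first by rewrite finite_setU; split; apply: finite_image.
have XI : X `<=` I.
  by move=> _ [[M hM <-]|[M hM <-]] /=; have [] := hf _ hM.
apply/seteqP; split; last exact: span_min.
move=> z Iz; apply: (local_global rD (span_submodule D X)) => M hM.
have [_ _ /(_ _ Iz)[d [Dd nMd hd]]] := hf _ hM; exists d; split=> //.
move: hd; apply: gen2_min; first exact: span_submodule.
- by apply: sub_span; left; exists M.
- by apply: sub_span; right; exists M.
Qed.

(** For [x = a / b] the ideal generated by [a] and [b] has an inverse
    containing some [j] with [a j] or [b j] outside [M], and
    [x = (a j) / (b j)]. *)
Lemma Prufer_localization M : is_Prufer D -> Max D M ->
  is_valuation_domain (localization D M).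
Proof.
move=> pD hM x x0; have [a [b [Da Db b0 e]]] := dD.2 x.
have a0 : a != 0 by apply: contra_neq x0 => a0; rewrite e a0 mul0r.
have [sM MD] : is_ideal D M by have [] := hM.
have iI := gen2_ideal rD Da Db.
have I0 : gen2 D a b <> [set 0] by apply: nonzero_set b0 _; apply: gen2_r.
have fI : finitely_generated D (gen2 D a b).
  by exists [set a; b]; [exact: finite_set2|rewrite span2].
have [J [_ eJ]] := pD _ iI I0 fI.
have prodD i j : gen2 D a b i -> J j -> D (i * j).
  by move=> Ii Jj; rewrite -[X in X _]eJ; apply: mem_ideal_mul.
have [j [Jj h]] : exists j, J j /\ (~ M (a * j) \/ ~ M (b * j)).
  apply: contrapT => h; apply: (max_not1 rD hM).
  have : ideal_mul D (gen2 D a b) J 1 by rewrite eJ; apply: subring1.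
  apply: ideal_mul_sub => // i j [c [d [Dc Dd ->]]] Jj.
  have [Maj Mbj] : M (a * j) /\ M (b * j).
    by split; apply: contrapT => hn; apply: h; exists j; split=> //; [left|right].
  rewrite mulrDl -!mulrA.
  by apply: (submoduleD sM); apply: (submoduleZ sM).
have Daj := prodD _ _ (gen2_l a b rD) Jj; have Dbj := prodD _ _ (gen2_r a b rD) Jj.
case: h => nM; have := notin_max_neq0 hM nM; rewrite mulf_eq0 negb_or => /andP[_ j0].
- right; exists (b * j), (a * j); split=> //.
  by rewrite e; field; rewrite a0 j0 b0.
- left; exists (a * j), (b * j); split=> //.
  by rewrite e; field; rewrite j0 b0.
Qed.

Lemma common_denominator M X : Max D M -> finite_set X ->
  X `<=` localization D M ->
  exists s, [/\ D s, ~ M s & forall x, X x -> D (s * x)].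
Proof.
move=> hM /finite_seqP[l ->]; elim: l => [|x l IHl] h.
  by exists 1; split; [exact: subring1|exact: max_not1 hM|].
have [y /= ly|s [Ds nMs hs]] := IHl; first by apply: h; rewrite /= inE ly orbT.
have [|a [t [Da Dt nMt e]]] := h x; first by rewrite /= inE eqxx.
exists (s * t); split; [exact: subringM|exact: (max_mul rD hM)|].
move=> y /=; rewrite inE => /orP[/eqP ->|ly].
- rewrite e -mulrA (mulrC t) divfK; first exact: subringM.
  exact: (notin_max_neq0 hM).
- by rewrite mulrAC; apply: subringM => //; apply: hs.
Qed.

(** Locally at [M] a finitely generated ideal is generated by one of its
    generators [x], and a common denominator of the other generators divided
    by [x] shows that the product with the inverse ideal is not in [M]. *)
Lemma Prufer_of_local :
  (forall M, Max D M -> is_valuation_domain (localization D M)) ->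
  is_Prufer D.
Proof.
move=> vD I iI I0 [X fX eI]; have sI := iI.1.
have [i i0 Ii] := nonzero_elt sI I0.
pose J := [set y | forall x, I x -> D (x * y)].
have sJ : is_submodule D J.
  split=> [x _|x y Jx Jy z Iz|a x Da Jx z Iz].
  - by rewrite mulr0; apply: subring0.
  - by rewrite mulrDr; apply: subringD; [|apply: Jx|apply: Jy].
  - by rewrite mulrCA; apply: subringM => //; apply: Jx.
exists J; split.
  split=> //; exists i; split=> // [|y Jy]; first exact: iI.2.
  exact: Jy.
have sID := span_submodule D [set z | exists x y, [/\ I x, J y & z = x * y]].
apply/seteqP; split.
  apply: ideal_mul_sub; first exact: is_submodule_self.
  by move=> x y Ix Jy; apply: Jy.
move=> z Dz; rewrite -(mulr1 z); apply: (submoduleZ sID) => //.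
apply: (local_global rD sID) => M hM.
have [x Xx x0] : exists2 x, X x & x != 0.
  apply: contrapT => h; apply: I0; rewrite eI; apply/seteqP; split=> [|_ ->].
    apply: span_min; last first.
      by move=> x Xx; apply/eqP/negPn/negP => x0; apply: h; exists x.
    by split=> //= [? ? -> ->|? ? _ ->]; rewrite ?addr0 ?mulr0.
  exact: submodule0 (span_submodule D X).
have rL := localization_subring dD hM.
have [{x0 Xx}x [Xx x0 XL]] := valuation_max_divisor rL (vD _ hM) fX (ex_intro2 _ _ x Xx x0).
have [_ [y Xy <-]|s [Ds nMs hs]] := common_denominator (X := (fun y => y / x) @` X) hM (finite_image _ fX).
  exact: XL.
exists s; split=> //; rewrite mulr1 -(divfK x0 s) mulrC; apply: mem_ideal_mul.
  by rewrite eI; apply: sub_span.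
move=> w; rewrite eI; pose N := [set w | D (w * (s / x))].
suff : span D X `<=` N by apply.
apply: span_min; last first.
  by move=> y Xy; rewrite /N /= mulrCA; apply: hs; exists y.
split; rewrite /N /=.
- by rewrite mul0r; apply: subring0.
- by move=> a b; rewrite mulrDl; apply: subringD.
- by move=> a b Da Nb; rewrite -mulrA; apply: subringM.
Qed.

(** The [z] that multiply [I] into the span of a finite subset of [I] form
    a submodule containing every [x y] with [x] in [I] and [y] in [J], hence
    containing [1]. *)
Lemma invertible_fg I : is_ideal D I -> is_invertible D I ->
  finitely_generated D I.
Proof.
move=> [sI ID] [J [_ eJ]].
pose N := [set z | exists X, [/\ finite_set X, X `<=` I &
  forall w, I w -> span D X (z * w)]].
have sN : is_submodule D N.
  split.
  - exists set0; split=> // w _; rewrite mul0r; exact: submodule0 (span_submodule _ _).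
  - move=> x y [X [fX XI hX]] [Y [fY YI hY]]; exists (X `|` Y); split.
    + by rewrite finite_setU.
    + by move=> z [/XI|/YI].
    + move=> w Iw; rewrite mulrDl; apply: (submoduleD (span_submodule _ _)).
      * move: (hX _ Iw); apply: span_min; first exact: span_submodule.
        by move=> z Xz; apply: sub_span; left.
      * move: (hY _ Iw); apply: span_min; first exact: span_submodule.
        by move=> z Yz; apply: sub_span; right.
  - move=> a x Da [X [fX XI hX]]; exists X; split=> // w Iw.
    by rewrite -mulrA; apply: (submoduleZ (span_submodule _ _)) => //; apply: hX.
have [X [fX XI hX]] : N 1.
  have : ideal_mul D I J 1 by rewrite eJ; apply: subring1.
  apply: ideal_mul_sub => // x y Ix Jy; exists [set x].
  split; [exact: finite_set1|by move=> _ ->|].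
  move=> w Iw; rewrite mulrC mulrCA mulrC; apply: (submoduleZ (span_submodule _ _)).
    rewrite -[X in X _]eJ -[w * y]/(w * y); exact: mem_ideal_mul.
  exact: sub_span.
exists X => //; apply/seteqP; split; last exact: span_min.
by move=> w Iw; rewrite -(mul1r w); apply: hX.
Qed.

Lemma Dedekind_Noetherian_Prufer :
  is_Dedekind D <-> is_Noetherian D /\ is_Prufer D.
Proof.
split=> [dedD|[nD pD] I iI I0]; last by apply: pD => //; apply: nD.
split=> [I iI|I iI I0 _]; last exact: dedD.
have [->|I0] := pselect (I = [set 0]); last exact: invertible_fg (dedD _ iI I0).
by exists [set 0; 0]; [exact: finite_set2|rewrite span2 // gen2_zero].
Qed.

End GlobalProperties.

(** * Counting the quasi-local overrings *)

Lemma card_setU_disjoint (T : choiceType) (A B : set T) m n :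
  A #= `I_m -> B #= `I_n -> A `&` B = set0 -> A `|` B #= `I_(m + n).
Proof.
move=> Am Bn AB0.
have fA : finite_set A by apply/finite_setP; exists m.
have fB : finite_set B by apply/finite_setP; exists n.
have fAB : finite_set (A `|` B) by rewrite finite_setU.
rewrite -(fset_setK fAB); apply/card_eq_fsetP.
rewrite fset_setU // cardfsU (card_fset_set Am) (card_fset_set Bn).
by rewrite -fset_setI // AB0 fset_set0 cardfs0 subn0.
Qed.

Section GMPD.
Variables (R : realType) (K : fieldType) (D : set K).
Hypotheses (dD : is_domain_of D) (nF : ~ is_field D) (gD : is_GMPD D).
Implicit Types (M N E B : set K).
Let L := localization D.
Let N M := extension D M M.

Lemma GMPD_pinched M : Max D M -> exists Q, pinched (L M) (N M) Q.
Proof.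
by move=> hM; apply: pinched_of_MPD; [exact: localization_local|exact: gD.2].
Qed.

Lemma K1P M : Max D M -> in_K1 (L M) <-> ~ is_valuation_domain (L M).
Proof.
move=> hM; have [Q pL] := GMPD_pinched hM; split; last exact: nonvaluation_K1 pL.
exact: K1_nonvaluation (localization_local dD hM) (extension_max_neq0 dD hM nF).
Qed.

Lemma K2P M : Max D M -> in_K2 R (L M) <-> nondiscrete (L M) (N M).
Proof.
move=> hM; have [Q pL] := GMPD_pinched hM; split.
  exact: K2_nondiscrete (localization_local dD hM).
exact: nondiscrete_K2 pL (extension_max_neq0 dD hM nF).
Qed.

Lemma K3P M : Max D M -> in_K3 (L M) <-> rank_two (L M) (N M).
Proof.
move=> hM; have [Q pL] := GMPD_pinched hM; split; last exact: rank_two_K3 pL.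
exact: K3_rank_two (localization_local dD hM).
Qed.

Lemma K4P M : Max D M -> in_K4 (L M) <-> discrete (L M) (N M).
Proof.
move=> hM; have [Q pL] := GMPD_pinched hM; split.
  exact: K4_discrete (localization_local dD hM).
exact: discrete_DVR (localization_local dD hM).
Qed.

Let S1 := [set M | Max D M /\ in_K1 (L M)].
Let S2 := [set M | Max D M /\ in_K2 R (L M)].
Let S3 := [set M | Max D M /\ in_K3 (L M)].
Let S4 := [set M | Max D M /\ in_K4 (L M)].

Lemma Max_types : Max D = (S1 `|` S3) `|` (S2 `|` S4).
Proof.
apply/seteqP; split=> M; last by case=> -[] [].
move=> hM; have [vL|nv] := pselect (is_valuation_domain (L M)); last first.
  by left; left; split=> //; apply/K1P.
have [h|h|h] := valuation_types (localization_local dD hM) vL.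
- by right; left; split=> //; apply/K2P.
- by left; right; split=> //; apply/K3P.
- by right; right; split=> //; apply/K4P.
Qed.

Lemma types_disjoint13 : S1 `&` S3 = set0.
Proof.
apply/seteqP; split=> // M [[hM /(K1P hM) nv] [_ [vL _]]]; exact: nv.
Qed.

Lemma types_disjoint24 : S2 `&` S4 = set0.
Proof.
apply/seteqP; split=> // M [[hM /(K2P hM)[_ npM]] [_ /(K4P hM)]].
by move/discrete_principal.
Qed.

Lemma types_disjoint : (S1 `|` S3) `&` (S2 `|` S4) = set0.
Proof.
apply/seteqP; split=> // M [[[hM h]|[hM h]] [[_ h']|[_ h']]].
- by move/(K1P hM): h; case: h' => vL _ /(_ vL).
- by move/(K1P hM): h; case: h' => vL _ /(_ vL).
- by move/(K3P hM): h => /rank_two_principal; move/(K2P hM): h' => [_ h' /h'].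
- move/(K3P hM): h; move/(K4P hM): h'.
  exact: discrete_not_rank_two (localization_local dD hM).
Qed.

Lemma middle_exists M : (S1 `|` S3) M -> exists E, middle_overring (L M) E.
Proof.
move=> [[hM h]|[hM h]]; have [Q pL] := GMPD_pinched hM.
- by apply: nonvaluation_middle pL _; apply/(K1P hM).
- by apply: rank_two_middle pL _; apply/(K3P hM).
Qed.

Lemma maximal_subring_types M : (S2 `|` S4) M -> maximal_subring (L M).
Proof.
move=> [[hM h]|[hM h]]; have [Q pL] := GMPD_pinched hM.
- by apply: nondiscrete_overrings pL _; apply/(K2P hM).
- by apply: discrete_overrings (localization_local dD hM) _; apply/(K4P hM).
Qed.

Lemma overring_max_uniq B M M' : O_ql D B -> B <> setT ->
  Max D M -> Max D M' -> L M `<=` B -> L M' `<=` B -> M = M'.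
Proof.
move=> oB nB hM hM' MB MB'.
have [M0 [_ uM]] := quasi_local_overring_max dD gD.1 oB nB.
by rewrite -(uM M) ?(uM M').
Qed.

Lemma O_ql_localization M : Max D M -> O_ql D (L M).
Proof.
move=> hM; split; last exact: local_quasi_local (localization_local dD hM).
by split; [exact: localization_subring|exact: localization_sub].
Qed.

Lemma O_ql_middle M E : Max D M -> middle_overring (L M) E -> O_ql D E.
Proof.
move=> hM [[rE LE] qE _ _ _]; split=> //; split=> // x Dx.
by apply: LE; apply: localization_sub.
Qed.

Lemma card_O_ql n1 n2 n3 n4 :
  S1 #= `I_n1 -> S2 #= `I_n2 -> S3 #= `I_n3 -> S4 #= `I_n4 ->
  O_ql D #= `I_(2 * (n1 + n3) + (n2 + n4) + 1).
Proof.
move=> c1 c2 c3 c4.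
have c13 := card_setU_disjoint c1 c3 types_disjoint13.
have c24 := card_setU_disjoint c2 c4 types_disjoint24.
have := card_setU_disjoint c13 c24 types_disjoint; rewrite -Max_types => cMax.
have SMax M : (S1 `|` S3) M -> Max D M by rewrite Max_types; left.
have /choice[E hE] M : exists E, (S1 `|` S3) M -> middle_overring (L M) E.
  have [hM|nM] := pselect ((S1 `|` S3) M); last by exists setT.
  by have [E hE] := middle_exists hM; exists E.
have LT M : Max D M -> L M <> setT by move=> hM; exact: localization_neqT.
have LE M : (S1 `|` S3) M -> L M `<=` E M by move=> /hE[[_]].
have ET M : (S1 `|` S3) M -> E M <> setT by move=> /hE[].
have oE M : (S1 `|` S3) M -> O_ql D (E M).
  by move=> hM; apply: O_ql_middle (hE _ hM); apply: SMax.
have injL : {in Max D &, injective L}.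
  move=> M M' /set_mem hM /set_mem hM' e.
  apply: (overring_max_uniq (O_ql_localization hM) (LT _ hM) hM hM') => //.
  by rewrite e.
have injE : {in S1 `|` S3 &, injective E}.
  move=> M M' /set_mem hM /set_mem hM' e.
  apply: (overring_max_uniq (oE _ hM) (ET _ hM)); try exact: SMax.
    exact: LE.
  by rewrite e; apply: LE.
have cL : L @` Max D #= `I_(n1 + n3 + (n2 + n4)).
  by rewrite (card_eql (inj_card_eq injL)).
have cE : E @` (S1 `|` S3) #= `I_(n1 + n3).
  by rewrite (card_eql (inj_card_eq injE)).
(* A ring [E M'] contains [L M] for [M = M'] only, and is not [L M'] itself. *)
have cLE : L @` Max D `|` E @` (S1 `|` S3) #=
    `I_(n1 + n3 + (n2 + n4) + (n1 + n3)).
  apply: (card_setU_disjoint cL cE); apply/seteqP; split=> // _ [[M hM <-]].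
  move=> [M' hM' e].
  have eM : M' = M.
    apply: (overring_max_uniq (oE _ hM') (ET _ hM')) => //; first exact: SMax.
      exact: LE.
    by rewrite e.
  by have [_ _ nE _ _] := hE _ hM'; apply: nE; rewrite e eM.
have -> : O_ql D = L @` Max D `|` E @` (S1 `|` S3) `|` [set setT].
  apply/seteqP; split=> B; last first.
    move=> [[[M hM <-]|[M hM <-]]|->].
    - exact: O_ql_localization.
    - exact: oE.
    - exact: O_ql_setT.
  move=> oB; have [->|nB] := pselect (B = setT); [by right|left].
  have [M [[hM LB] _]] := quasi_local_overring_max dD gD.1 oB nB.
  have oLB : is_overring (L M) B by split=> //; have [[]] := oB.
  have := hM; rewrite {1}Max_types => -[hM'|hM'].
  - have [_ _ _ _ h] := hE _ hM'.
    have [->|->|//] := h _ oLB; first by left; exists M.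
    by right; exists M.
  - by have [->|//] := maximal_subring_types hM' oLB; left; exists M.
rewrite (_ : _ + 1 = n1 + n3 + (n2 + n4) + (n1 + n3) + 1)%N; last by lia.
apply: (card_setU_disjoint cLE card_set1); apply/seteqP; split=> // _ [[[M hM <-]|[M hM <-]]].
- exact: LT.
- exact: ET.
Qed.

Lemma Noetherian_types : finite_set (Max D) ->
  is_Noetherian D <-> S2 = set0 /\ S3 = set0.
Proof.
move=> fM; split=> [nD|[e2 e3]].
- have disc M : Max D M -> is_valuation_domain (L M) -> discrete (L M) (N M).
    by move=> hM; apply: Noetherian_valuation_discrete.
  split; apply/seteqP; split=> // M [hM h].
  + move/(K2P hM): h => [vL []]; apply: discrete_principal; exact: disc.
  + move/(K3P hM): h => h; have [vL _] := h.
    exact: discrete_not_rank_two (localization_local dD hM) (disc _ hM vL) h.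
- apply: (Noetherian_of_local dD fM) => M I hM.
  have [Q pL] := GMPD_pinched hM.
  have := hM; rewrite {1}Max_types e2 e3 setU0 set0U => -[[_ h]|[_ h]].
  + by apply: (nonvaluation_two_generated pL); apply/(K1P hM).
  + by apply: (discrete_two_generated pL); apply/(K4P hM).
Qed.

Lemma Prufer_types : is_Prufer D <-> S1 = set0.
Proof.
split=> [pD|e1].
- apply/seteqP; split=> // M [hM /(K1P hM)]; apply.
  exact: Prufer_localization.
- apply: (Prufer_of_local dD) => M hM; apply: contrapT => nv.
  by have : S1 M by [split=> //; apply/K1P]; rewrite e1.
Qed.

End GMPD.

Local Close Scope ring_scope.

Theorem theorem10 (R : realType) (K : fieldType) (D : set K)
    (n1 n2 n3 n4 : nat)
    (domD : is_domain_of D) (nfD : ~ is_field D)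
    (gmpdD : is_GMPD D) (finMax : finite_set (Max D))
    (hn1 : [set M | Max D M /\ in_K1 (localization D M)] #= `I_n1)
    (hn2 : [set M | Max D M /\ in_K2 R (localization D M)] #= `I_n2)
    (hn3 : [set M | Max D M /\ in_K3 (localization D M)] #= `I_n3)
    (hn4 : [set M | Max D M /\ in_K4 (localization D M)] #= `I_n4) :
  [/\ O_ql D #= `I_(2 * (n1 + n3) + (n2 + n4) + 1),
      is_Noetherian D <-> O_ql D #= `I_(2 * n1 + n4 + 1),
      is_Prufer D <-> O_ql D #= `I_(2 * n3 + (n2 + n4) + 1)
    & is_Dedekind D <-> O_ql D #= `I_(n4 + 1)].
Proof.
have card := card_O_ql domD nfD gmpdD hn1 hn2 hn3 hn4.
have cardE k : O_ql D #= `I_k <-> 2 * (n1 + n3) + (n2 + n4) + 1 = k.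
  rewrite (card_eql card); split; first by move/card_eq_II.
  by move/card_eq_II.
have empty (S : set (set K)) n : S #= `I_n -> S = set0 <-> n = 0.
  move=> Sn; split=> [e|n0].
    by move: Sn; rewrite e card_eq_sym => Sn; apply: IIn_eq0; apply/eqP; rewrite -(card_eq0 (T:=nat) (U:=set K)).
  by move: Sn; rewrite n0 II0 card_eq0 => /eqP.
have nP := Noetherian_types R domD nfD gmpdD finMax.
have pP := Prufer_types domD nfD gmpdD.
have e1 := empty _ _ hn1; have e2 := empty _ _ hn2; have e3 := empty _ _ hn3.
have dP := Dedekind_Noetherian_Prufer domD.
split; first exact: card.
- by rewrite nP cardE e2 e3; lia.
- by rewrite pP cardE e1; lia.
- by rewrite dP nP pP cardE e1 e2 e3; lia.
Qed.
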